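(* The restriction of $\Phi$ to $\mathbf{H}_{hpo}$ is injective; hence it is an injective morphism of graded Hopf algebras $\mathbf{H}_{hpo}\to\mathbf{WQSym}^*$.
   Context: $\mathbb{K}$ is a field of characteristic zero. Rooted forests are considered up to isomorphism; $v\twoheadrightarrow w$ means there is an oriented path (possibly of length $0$) from $v$ towards the root ending at $w$. A preordered forest is $(F,\sigma)$ with $\sigma:V(F)\to\{1,\dots,q\}$ surjective; $\mathbf{H}_{po}$ is the Hopf algebra spanned by preordered forests with product the disjoint union ($\sigma^F$ on $V(F)$, $\sigma^G+\max\sigma^F$ on $V(G)$) and coproduct $\sum_{\boldsymbol v}Lea_{\boldsymbol v}(F)\otimes Roo_{\boldsymbol v}(F)$ over admissible cuts (sets of pairwise $\twoheadrightarrow$-unrelated vertices; $Lea$ is induced on vertices above the cut, $Roo$ on the rest, preorders restricted). A heap-preordered forest is one with $a\ne b$, $a\twoheadrightarrow b\Rightarrow\sigma(a)>\sigma(b)$; $\mathbf{H}_{hpo}$ is the Hopf subalgebra they span. $\mathbf{WQSym}^*$ has basis the packed words $\tau\in Surj_n$ (maps $\{1,\dots,n\}\to\{1,\dots,k\}$ onto), product of $\sigma,\tau$ = sum of shuffles of $\sigma$ with $\tau$ shifted by $\max\sigma$, coproduct $\sum_i pack(\tau(1)\dots\tau(i))\otimes pack(\tau(i+1)\dots\tau(n))$. $\Phi:\mathbf{H}_{po}\to\mathbf{WQSym}^*$ is the Hopf algebra morphism $\Phi((F,\sigma))=\sum_{\tau\in Surj_{|F|_v}}\mathrm{card}(\mathbb{S}^\tau_{(F,\sigma)})\tau$,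 where $\mathbb{S}^\tau_{(F,\sigma)}$ is the set of bijections $\varphi:V(F)\to\{1,\dots,|F|_v\}$ with $\sigma=\tau\circ\varphi$ and $v'\twoheadrightarrow v\Rightarrow\varphi(v)\ge\varphi(v')$. *)

(* Defs.v *)
From HB Require Import structures.
From mathcomp Require Import all_boot all_order all_algebra.
From mathcomp Require Import finmap monalg.

Set Implicit Arguments.
Unset Strict Implicit.
Unset Printing Implicit Defensive.

Import GRing.Theory.

Local Open Scope ring_scope.
Local Open Scope quotient_scope.

Section FreeModules.
Variable K : fieldType.

Definition lin (B : choiceType) (M : lmodType K) (f : B -> M)
  (x : {malg K[B]}) : M := \sum_(b <- msupp x) x@_b *: f b.

(* The tensor product of {malg K[A]} and {malg K[B]} is {malg K[A * B]}. *)
Definition tens (A B : choiceType) (x : {malg K[A]}) (y : {malg K[B]}) :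
    {malg K[(A * B)%type]} :=
  lin (fun a => lin (fun b => << (a, b) >>) y) x.

Definition tens_map (A B A' B' : choiceType)
    (f : {malg K[A]} -> {malg K[A']}) (g : {malg K[B]} -> {malg K[B']}) :
    {malg K[(A * B)%type]} -> {malg K[(A' * B')%type]} :=
  lin (fun ab : A * B => tens (f << ab.1 >>) (g << ab.2 >>)).

Definition span_of (B : choiceType) (P : pred B) : pred {malg K[B]} :=
  fun x => all P (msupp x).

Definition pair_pred (A B : choiceType) (P : pred A) (Q : pred B) :
  pred (A * B) := fun ab => P ab.1 && Q ab.2.

(* The operations of a graded Hopf algebra with homogeneous basis B, whose unit
   is a basis element. *)
Record hopf_ops (B : choiceType) := HopfOps {
  hone : B;
  hmulb : B -> B -> {malg K[B]};
  hcounitb : B -> K;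
  hcomulb : B -> {malg K[(B * B)%type]};
  hdegb : B -> nat }.

Section Operations.
Variables (B : choiceType) (H : hopf_ops B).

Definition hunit : {malg K[B]} := << hone H >>.
Definition hmul (x y : {malg K[B]}) : {malg K[B]} :=
  lin (fun a => lin (hmulb H a) y) x.
Definition hcounit (x : {malg K[B]}) : K := \sum_(b <- msupp x) x@_b * hcounitb H b.
Definition hcomul : {malg K[B]} -> {malg K[(B * B)%type]} := lin (hcomulb H).
Definition homogeneous (n : nat) : pred {malg K[B]} :=
  span_of (fun b => hdegb H b == n).
Definition hmul2 : {malg K[(B * B)%type]} -> {malg K[B]} :=
  lin (fun ab : B * B => hmul << ab.1 >> << ab.2 >>).

(* S restricted to span_of P is an antipode of span_of P; its values elsewhere
   are irrelevant. *)
Record is_antipode_on (P : pred B) (S : {malg K[B]} -> {malg K[B]}) : Prop :=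
  AntipodeOn {
  antipode_stable : {in span_of P, forall x, span_of P (S x)};
  antipode_linear : forall (c : K), {in span_of P &, forall x y,
    S (c *: x + y) = c *: S x + S y};
  antipode_left : {in span_of P, forall x,
    hmul2 (tens_map S id (hcomul x)) = hcounit x *: hunit};
  antipode_right : {in span_of P, forall x,
    hmul2 (tens_map id S (hcomul x)) = hcounit x *: hunit} }.

Record is_hopf_subalgebra (P : pred B) : Prop := HopfSubalgebra {
  sub_unit : span_of P hunit;
  sub_mul : {in span_of P &, forall x y, span_of P (hmul x y)};
  sub_comul : {in span_of P, forall x, span_of (pair_pred P P) (hcomul x)};
  sub_antipode : forall S, is_antipode_on predT S ->
    {in span_of P, forall x, span_of P (S x)} }.

End Operations.

(* f restricted to the Hopf subalgebra span_of P of A is a morphism of graded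
   Hopf algebras into B. *)
Record is_graded_hopf_morphism_on (BA BB : choiceType)
    (A : hopf_ops BA) (P : pred BA) (B : hopf_ops BB)
    (f : {malg K[BA]} -> {malg K[BB]}) : Prop := GradedHopfMorphismOn {
  mor_linear : forall (c : K), {in span_of P &, forall x y,
    f (c *: x + y) = c *: f x + f y};
  mor_unit : f (hunit A) = hunit B;
  mor_mul : {in span_of P &, forall x y, f (hmul A x y) = hmul B (f x) (f y)};
  mor_counit : {in span_of P, forall x, hcounit B (f x) = hcounit A x};
  mor_comul : {in span_of P, forall x,
    hcomul B (f x) = tens_map f f (hcomul A x)};
  mor_antipode : forall S T, is_antipode_on A P S -> is_antipode_on B predT T ->
    {in span_of P, forall x, f (S x) = T (f x)};
  mor_graded : forall n, {in span_of P, forall x,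
    homogeneous A n x -> homogeneous B n (f x)} }.

End FreeModules.

(* s takes exactly the values 1, ..., q for some q (its maximum). *)
Definition packed (s : seq nat) : bool :=
  [forall j : 'I_(\max_(x <- s) x).+1, ((j : nat) \in s) == (0 < j)%N].

Definition rank_in (s : seq nat) (x : nat) : nat :=
  size (undup [seq y <- s | (y <= x)%N]).

Definition pack (s : seq nat) : seq nat := map (rank_in s) s.

Lemma rank_in_mono s x y : x \in s -> y \in s ->
  (rank_in s x < rank_in s y)%N = (x < y)%N.
Proof.
have le a b : (a <= b)%N -> (rank_in s a <= rank_in s b)%N.
  move=> ab; apply: uniq_leq_size; first exact: undup_uniq.
  move=> z; rewrite !mem_undup !mem_filter => /andP[za ->].
  by rewrite (leq_trans za ab).
move=> xs ys; case: (ltnP x y) => [xy|yx]; last by rewrite ltnNge le.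
have : uniq (y :: undup [seq z <- s | (z <= x)%N]).
  by rewrite cons_uniq undup_uniq mem_undup mem_filter leqNgt xy.
move/uniq_leq_size; apply=> z; rewrite inE => /orP[/eqP->|].
  by rewrite mem_undup mem_filter leqnn.
rewrite !mem_undup !mem_filter => /andP[zx ->].
by rewrite (leq_trans zx (ltnW xy)).
Qed.

Lemma packedP s : reflect
  (exists q, forall j, (j \in s) = (0 < j <= q)%N) (packed s).
Proof.
apply: (iffP forallP) => [H|[q H] j].
  exists (\max_(x <- s) x)%N => j; case: (leqP j (\max_(x <- s) x)%N) => jm.
    by rewrite andbT; apply/eqP: (H (Ordinal (jm : (j < _.+1)%N))).
  rewrite andbF; apply/negP => js; move: jm.
  by rewrite ltnNge (@leq_bigmax_seq _ s predT id j).
have -> : ((j : nat) \in s) = (0 < j <= q)%N by rewrite H.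
have [->|] := posnP j; first by [].
move=> j0 /=; have : (j <= \max_(x <- s) x)%N by rewrite -ltnS.
move=> /leq_trans -> //; apply/bigmax_leqP_seq => x.
by rewrite H => /andP[].
Qed.

Lemma packed_pack s : packed (pack s).
Proof.
apply/packedP; exists (size (undup s)) => j.
set t := sort leq (undup s).
have ut : uniq t by rewrite sort_uniq undup_uniq.
have st : sorted ltn t.
  by rewrite ltn_sorted_uniq_leq ut sort_sorted //; exact: leq_total.
have mt z : (z \in t) = (z \in s) by rewrite mem_sort mem_undup.
have szt : size t = size (undup s) by rewrite size_sort.
have rkE i : (i < size t)%N -> rank_in s (nth 0%N t i) = i.+1.
  move=> it; rewrite /rank_in.
  have -> : i.+1 = size (take i.+1 t) by rewrite size_takel.
  apply: perm_size; apply: uniq_perm; rewrite ?undup_uniq ?take_uniq //.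
  move=> z; rewrite mem_undup mem_filter -mt.
  apply/andP/idP => [[zi zt]|zt].
    rewrite -(nth_index 0%N zt) -(@nth_take i.+1); last first.
      rewrite ltnS leqNgt; apply/negP => lt; move: zi; rewrite leqNgt.
      rewrite -{1}(nth_index 0%N zt).
      by rewrite (sorted_ltn_nth ltn_trans) // inE index_mem.
    apply: mem_nth; rewrite size_takel // ltnS leqNgt; apply/negP => lt.
    move: zi; rewrite leqNgt -{1}(nth_index 0%N zt).
    by rewrite (sorted_ltn_nth ltn_trans) // inE index_mem.
  have zt' := mem_take zt; split=> //.
  move: zt => /(nthP 0%N) [k]; rewrite size_takel // => ki <-.
  rewrite nth_take //; move: ki; rewrite ltnS leq_eqVlt => /orP[/eqP->//|ki].
  apply: ltnW; apply: (sorted_ltn_nth ltn_trans) => //.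
  by rewrite inE (ltn_trans ki).
apply/mapP/andP => [[x xs ->]|[j0 jq]].
  have xt : x \in t by rewrite mt.
  by rewrite -(nth_index 0%N xt) rkE ?index_mem // -szt index_mem.
exists (nth 0%N t j.-1).
  by rewrite -mt mem_nth // szt prednK.
by rewrite rkE ?prednK // szt.
Qed.

Record pword := PWord { pword_seq :> seq nat; _ : packed pword_seq }.
HB.instance Definition _ := [isSub for pword_seq].
HB.instance Definition _ := [Choice of pword by <:].

Definition pack_word (s : seq nat) : pword := PWord (packed_pack s).

Fixpoint shuffles (s : seq nat) : seq nat -> seq (seq nat) :=
  if s is a :: s' then
    fix shuffles_s (t : seq nat) : seq (seq nat) :=
      if t is b :: t' then
        map (cons a) (shuffles s' t) ++ map (cons b) (shuffles_s t')
      else [:: s]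
  else fun t => [:: t].

Section WQSym.
Variable K : fieldType.

(* The shuffles below are already packed words, hence unchanged by pack_word. *)
Definition wq_mulb (s t : pword) : {malg K[pword]} :=
  \sum_(w <- shuffles s [seq (x + \max_(y <- s) y)%N | x <- t])
    << pack_word w >>.

Definition wq_comulb (w : pword) : {malg K[(pword * pword)%type]} :=
  \sum_(i < (size w).+1) << (pack_word (take i w), pack_word (drop i w)) >>.

Definition WQSymd : hopf_ops K pword :=
  {| hone := pack_word [::];
     hmulb := wq_mulb;
     hcounitb := fun w => (size w == 0%N)%:R;
     hcomulb := wq_comulb;
     hdegb := fun w => size w |}.

End WQSym.

(* A rooted forest on V is a parent function: the edges go from v to its parent,
   roots have none. *)
Section Relations.
Variables (V : finType) (p : V -> option V).

Definition edge : rel V := fun v w => p v == Some w.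

(* above v w is v ->> w: an oriented path from v to w, possibly of length 0. *)
Definition above : rel V := connect edge.

Definition acyclic : bool := [forall v, forall w, edge v w ==> ~~ above w v].

End Relations.

Section PreorderedForest.
Variable V : finType.

Definition pforest_axiom (F : {ffun V -> option V} * {ffun V -> nat}) : bool :=
  acyclic F.1 && packed (codom F.2).

Record pforest := PForest {
  pforest_val : {ffun V -> option V} * {ffun V -> nat};
  _ : pforest_axiom pforest_val }.
HB.instance Definition _ := [isSub for pforest_val].
HB.instance Definition _ := [Choice of pforest by <:].

Definition parent (F : pforest) : {ffun V -> option V} := (pforest_val F).1.
Definition label (F : pforest) : {ffun V -> nat} := (pforest_val F).2.

Lemma pforestP (F : pforest) : acyclic (parent F) /\ packed (codom (label F)).
Proof. by case: F => -[p l] H; apply/andP. Qed.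

End PreorderedForest.

Lemma mk_pforest_subproof (V : finType) (p : V -> option V) (l : V -> nat) :
  acyclic p -> packed (codom l) ->
  pforest_axiom ([ffun v => p v], [ffun v => l v]).
Proof.
move=> ac pk; rewrite /pforest_axiom /=; apply/andP; split.
  apply/forallP => v; apply/forallP => w; apply/implyP => e.
  have E a b : edge [ffun v => p v] a b = edge p a b by rewrite /edge ffunE.
  rewrite /above (eq_connect E); move: ac => /forallP/(_ v)/forallP/(_ w).
  by move/implyP; apply; rewrite -E.
by rewrite (eq_codom (g := l)) // => v; rewrite ffunE.
Qed.

Definition mk_pforest (V : finType) (p : V -> option V) (l : V -> nat)
    (ac : acyclic p) (pk : packed (codom l)) : pforest V :=
  PForest (mk_pforest_subproof ac pk).

Lemma above_map (V W : finType) (p : V -> option V) (p' : W -> option W)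
    (f : W -> V) : (forall a b, p' a = Some b -> p (f a) = Some (f b)) ->
  forall a b, above p' a b -> above p (f a) (f b).
Proof.
move=> fE a b /connectP[s]; elim: s a => [|c s IH] a /=.
  by move=> _ ->; exact: connect0.
case/andP=> /eqP e ps lb; apply: connect_trans (IH _ ps lb).
by apply: connect1; apply/eqP; exact: fE.
Qed.

Lemma acyclic_map (V W : finType) (p : V -> option V) (p' : W -> option W)
    (f : W -> V) : (forall a b, p' a = Some b -> p (f a) = Some (f b)) ->
  acyclic p -> acyclic p'.
Proof.
move=> fE ac; apply/forallP => a; apply/forallP => b; apply/implyP => /eqP e.
apply/negP => /(above_map fE) ba.
move: ac => /forallP/(_ (f a))/forallP/(_ (f b))/implyP.
by rewrite /edge (fE _ _ e) eqxx ba => /(_ isT).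
Qed.

(* The subforest induced on A: a vertex whose parent is not in A becomes a root,
   and the restricted preorder is renumbered by 1, 2, ... *)
Section Restrict.
Variables (V : finType) (F : pforest V) (A : {set V}).
Let W := {v : V | v \in A}.

Definition restrict_parent (w : W) : option W := obind insub (parent F (val w)).
Definition restrict_label (w : W) : nat :=
  rank_in [seq label F (val u) | u : W] (label F (val w)).

Lemma restrict_acyclic : acyclic restrict_parent.
Proof.
apply: (@acyclic_map V W (parent F) _ val); last by case: (pforestP F).
move=> a b; rewrite /restrict_parent; case: (parent F (val a)) => //= c.
by case: insubP => // u _ <- [->].
Qed.

Lemma restrict_packed : packed (codom restrict_label).
Proof.
have -> : codom restrict_label = pack [seq label F (val u) | u : W].
  by rewrite /pack /codom /image_mem -map_comp.
exact: packed_pack.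
Qed.

Definition restrict : pforest {v : V | v \in A} :=
  mk_pforest restrict_acyclic restrict_packed.

End Restrict.

Section DisjointUnion.
Variables (V W : finType) (F : pforest V) (G : pforest W).

Definition union_parent (x : V + W) : option (V + W) :=
  match x with
  | inl v => omap inl (parent F v)
  | inr w => omap inr (parent G w)
  end.
Definition union_label (x : V + W) : nat :=
  match x with
  | inl v => label F v
  | inr w => (label G w + \max_v label F v)%N
  end.

Lemma union_acyclic : acyclic union_parent.
Proof.
have L a s : path (edge union_parent) (inl a) s ->
    exists2 b, last (inl a) s = inl b & above (parent F) a b.
  elim: s a => [|c s IH] a /=; first by exists a => //; exact: connect0.
  rewrite {1}/edge /=; case e: (parent F a) => [d|] //= /andP[/eqP[<-]] /IH.
  case=> b -> db; exists b => //; apply: connect_trans db.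
  by apply: connect1; apply/eqP.
have R a s : path (edge union_parent) (inr a) s ->
    exists2 b, last (inr a) s = inr b & above (parent G) a b.
  elim: s a => [|c s IH] a /=; first by exists a => //; exact: connect0.
  rewrite {1}/edge /=; case e: (parent G a) => [d|] //= /andP[/eqP[<-]] /IH.
  case=> b -> db; exists b => //; apply: connect_trans db.
  by apply: connect1; apply/eqP.
apply/forallP => x; apply/forallP => y; apply/implyP.
case: x => x; rewrite /edge /=.
  case e: (parent F x) => [d|] //= /eqP[<-]; apply/negP => /connectP[s].
  move=> /L[b ->] db [xb]; subst b.
  have /forallP/(_ x)/forallP/(_ d)/implyP := proj1 (pforestP F).
  by rewrite /edge e eqxx db => /(_ isT).
case e: (parent G x) => [d|] //= /eqP[<-]; apply/negP => /connectP[s].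
move=> /R[b ->] db [xb]; subst b.
have /forallP/(_ x)/forallP/(_ d)/implyP := proj1 (pforestP G).
by rewrite /edge e eqxx db => /(_ isT).
Qed.

Lemma union_packed : packed (codom union_label).
Proof.
have [_ /packedP[q Hq]] := pforestP F; have [_ /packedP[r Hr]] := pforestP G.
have mE : (\max_v label F v)%N = q.
  apply/eqP; rewrite eqn_leq; apply/andP; split.
    apply/bigmax_leqP => v _.
    by have := Hq (label F v); rewrite codom_f => /esym/andP[].
  have [->//|q0] := posnP q.
  have : q \in codom (label F) by rewrite Hq q0 leqnn.
  by case/codomP=> v ->; exact: leq_bigmax.
apply/packedP; exists (q + r)%N => j; apply/codomP/andP.
  case=> [[v|w]] -> /=.
    have := Hq (label F v); rewrite codom_f => /esym/andP[-> le].
    by rewrite (leq_trans le) ?leq_addr.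
  rewrite mE; have := Hr (label G w); rewrite codom_f => /esym/andP[p0 le].
  by rewrite addn_gt0 p0 addnC leq_add2l.
case=> j0 jqr; have [jq|qj] := leqP j q.
  have : j \in codom (label F) by rewrite Hq j0.
  by case/codomP=> v ->; exists (inl v).
have : (j - q)%N \in codom (label G) by rewrite Hr subn_gt0 qj leq_subLR.
by case/codomP=> w e; exists (inr w); rewrite /= mE -e subnK // ltnW.
Qed.

Definition union : pforest (V + W)%type := mk_pforest union_acyclic union_packed.

End DisjointUnion.

Definition piso (V W : finType) (F : pforest V) (G : pforest W) : bool :=
  [exists f : {ffun V -> W},
    [&& injectiveb f, #|V| == #|W|,
        [forall v, parent G (f v) == omap f (parent F v)]
      & [forall v, label G (f v) == label F v]]].

Lemma pisoP (V W : finType) (F : pforest V) (G : pforest W) :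
  reflect (exists f : V -> W, [/\ bijective f,
             forall v, parent G (f v) = omap f (parent F v)
           & forall v, label G (f v) = label F v])
          (piso F G).
Proof.
apply: (iffP existsP) => [[f /and4P[/injectiveP fi /eqP c /forallP fp /forallP fl]]|].
  exists f; split=> [|v|v]; [|exact/eqP|exact/eqP].
  by apply: inj_card_bij fi _; rewrite c.
case=> f [fb fp fl]; exists [ffun v => f v].
apply/and4P; split.
- by apply/injectiveP => x y; rewrite !ffunE; exact: bij_inj.
- by rewrite (bij_eq_card fb).
- apply/forallP => v; rewrite ffunE fp; apply/eqP.
  by case: (parent F v) => //= w; rewrite ffunE.
- by apply/forallP => v; rewrite ffunE fl.
Qed.

Lemma piso_refl (V : finType) (F : pforest V) : piso F F.
Proof.
apply/pisoP; exists id; split=> //; first by exists id.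
by move=> v; case: (parent F v).
Qed.

Lemma piso_sym (V W : finType) (F : pforest V) (G : pforest W) :
  piso F G -> piso G F.
Proof.
case/pisoP=> f [[g fK gK] fp fl]; apply/pisoP; exists g; split.
- by exists f.
- move=> w; have := fp (g w); rewrite gK => ->.
  by case: (parent F (g w)) => //= v; rewrite fK.
- by move=> w; rewrite -fl gK.
Qed.

Lemma piso_trans (V W X : finType) (F : pforest V) (G : pforest W)
  (H : pforest X) : piso F G -> piso G H -> piso F H.
Proof.
case/pisoP=> f [fb fp fl] /pisoP[g [gb gp gl]]; apply/pisoP; exists (g \o f).
split=> [|v|v] /=; first exact: bij_comp.
  by rewrite gp fp; case: (parent F v).
by rewrite gl fl.
Qed.

Definition raw_forest : choiceType := {n : nat & pforest 'I_n}.

Definition raw_iso : rel raw_forest := fun F G => piso (tagged F) (tagged G).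

Lemma raw_iso_equiv : equiv_class_of raw_iso.
Proof.
split=> [F|F G|G F H]; first exact: piso_refl.
- by apply/idP/idP; exact: piso_sym.
- exact: piso_trans.
Qed.

Canonical raw_iso_rel := EquivRelPack raw_iso_equiv.

Definition forest_class : choiceType := {eq_quot raw_iso}.

Definition fsize (c : forest_class) : nat := tag (repr c).
Definition frepr (c : forest_class) : pforest 'I_(fsize c) := tagged (repr c).

Section Transport.
Variables (V : finType) (F : pforest V).

Definition transport_parent (i : 'I_#|V|) : option 'I_#|V| :=
  omap enum_rank (parent F (enum_val i)).
Definition transport_label (i : 'I_#|V|) : nat := label F (enum_val i).

Lemma transport_acyclic : acyclic transport_parent.
Proof.
apply: (@acyclic_map V _ (parent F) _ enum_val); last by case: (pforestP F).
move=> a b; rewrite /transport_parent; case: (parent F _) => //= c [<-].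
by rewrite enum_rankK.
Qed.

Lemma transport_packed : packed (codom transport_label).
Proof.
have [_ /packedP[q Hq]] := pforestP F; apply/packedP; exists q => j.
rewrite -Hq; apply/codomP/codomP => [[i ->]|[v ->]].
  by exists (enum_val i).
by exists (enum_rank v); rewrite /transport_label enum_rankK.
Qed.

Definition transport : pforest 'I_#|V| :=
  mk_pforest transport_acyclic transport_packed.

Definition class_of : forest_class :=
  \pi_forest_class (Tagged (fun n => pforest 'I_n) transport : raw_forest).

End Transport.

Lemma pi_raw_eq (F G : raw_forest) :
  (\pi_forest_class F = \pi_forest_class G) <-> piso (tagged F) (tagged G).
Proof. by split=> [/eqmodP|H]; last exact/eqmodP. Qed.

Lemma void_acyclic : acyclic (fun x : void => None).
Proof. by apply/forallP => -[]. Qed.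

Lemma void_packed : packed (codom (fun x : void => 0%N)).
Proof.
apply/packedP; exists 0%N => j.
rewrite lt0n; case: j => [|j] /=; first by apply/negbTE/codomP => -[[]].
by apply/negbTE/codomP => -[[]].
Qed.

Definition empty_forest : pforest void := mk_pforest void_acyclic void_packed.

Section Forests.
Variables (V : finType) (F : pforest V).
Let abv := above (parent F).

Definition heap : bool :=
  [forall a, forall b, (a != b) && abv a b ==> (label F b < label F a)%N].

(* Admissible cuts; the empty cut and the cut at all the roots are allowed. *)
Definition admissible (c : {set V}) : bool :=
  [forall a in c, forall b in c, (a != b) ==> ~~ abv a b].

Definition above_cut (c : {set V}) : {set V} := [set w | [exists v in c, abv w v]].

Definition Lea (c : {set V}) : forest_class := class_of (restrict F (above_cut c)).
Definition Roo (c : {set V}) : forest_class :=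
  class_of (restrict F (~: above_cut c)).

(* A position is an element of 'I_#|V| (numbered from 0), and
   an injection between sets of the same cardinality is a bijection. *)
Definition linearizations (tau : #|V|.-tuple 'I_#|V|.+1) :
    {set {ffun V -> 'I_#|V|}} :=
  [set phi : {ffun V -> 'I_#|V|} |
    [&& injectiveb phi,
        [forall v, label F v == tnth tau (phi v)]
      & [forall v', forall v, abv v' v ==> (phi v' <= phi v)%N]]].

End Forests.

Section Hpo.
Variable K : fieldType.

Definition po_mulb (c d : forest_class) : {malg K[forest_class]} :=
  << class_of (union (frepr c) (frepr d)) >>.

Definition po_comulb (c : forest_class) :
    {malg K[(forest_class * forest_class)%type]} :=
  \sum_(v : {set 'I_(fsize c)} | admissible (frepr c) v)
    << (Lea (frepr c) v, Roo (frepr c) v) >>.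

Definition Hpo : hopf_ops K forest_class :=
  {| hone := class_of empty_forest;
     hmulb := po_mulb;
     hcounitb := fun c => (fsize c == 0%N)%:R;
     hcomulb := po_comulb;
     hdegb := fsize |}.

Definition heap_class : pred forest_class := fun c => heap (frepr c).

Definition Hhpo : pred {malg K[forest_class]} := span_of heap_class.

(* The words of Surj_n have letters at most n; pack_word is only applied to
   words that are already packed. *)
Definition Phi_forest (V : finType) (F : pforest V) : {malg K[pword]} :=
  \sum_(tau : #|V|.-tuple 'I_#|V|.+1 | packed (map val tau))
    #|linearizations F tau|%:R *: << pack_word (map val tau) >>.

Definition Phi : {malg K[forest_class]} -> {malg K[pword]} :=
  lin (fun c => Phi_forest (frepr c)).

End Hpo.

Arguments Hhpo K x : clear implicits.
Arguments Phi K x : clear implicits.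

(* Main.v *)
(** The map [Phi] is the sum, over all linear extensions of the forest listed from
    the leaves to the roots, of the words of labels they spell.  Shuffling the
    extensions of two forests gives multiplicativity; cutting an extension after
    its first letters amounts to choosing a set of vertices closed upwards, that is
    an admissible cut, together with an extension of each side, which gives the
    coproduct.  Both coalgebras are connected, so an antipode is computed
    recursively from its left inverse property; comparing the two recursions shows
    that [Phi] commutes with the antipodes, without coassociativity.

    For injectivity, order words lexicographically from the right.  In the greatest
    word of a heap-preordered forest, the parent of a vertex is the first later
    vertex with a smaller label: otherwise the vertex could be moved past that one,
    giving a greater word.  Hence the greatest word determines the forest, and
    [Phi] is triangular for this order. *)

From HB Require Import structures.
Require Import Defs.
From mathcomp Require Import all_boot all_order all_algebra.
From mathcomp Require Import finmap monalg.

Set Implicit Arguments.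
Unset Strict Implicit.
Unset Printing Implicit Defensive.

Import Order.TTheory GRing.Theory.

Local Open Scope ring_scope.
Local Open Scope quotient_scope.

(** * Linear and bilinear extension *)

Section FreeModuleTheory.
Variable K : fieldType.

(** Coefficients vanish off the support, so elements with different supports can be summed over one
    common finite set. *)
Lemma lin_supp (B : choiceType) (M : lmodType K) (f : B -> M) x (d : {fset B}) :
  (msupp x `<=` d)%fset -> lin f x = \sum_(b <- d) x@_b *: f b.
Proof.
move=> xd; rewrite /lin (big_fset_incl _ xd) // => b _ /mcoeff_outdom ->.
by rewrite scale0r.
Qed.

Lemma lin_is_linear (B : choiceType) (M : lmodType K) (f : B -> M) :
  linear (lin f).
Proof.
move=> c x y; set d := (msupp x `|` msupp y)%fset.
have dx : (msupp x `<=` d)%fset by exact: fsubsetUl.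
have dy : (msupp y `<=` d)%fset by exact: fsubsetUr.
have dz : (msupp (c *: x + y) `<=` d)%fset.
  by apply: fsubset_trans (msuppD_le _ _) _; apply: fsetSU; exact: msuppZ_le.
rewrite (lin_supp _ dx) (lin_supp _ dy) (lin_supp _ dz) scaler_sumr -big_split.
by apply: eq_bigr => b _; rewrite mcoeffD mcoeffZ scalerDl scalerA.
Qed.
HB.instance Definition _ (B : choiceType) (M : lmodType K) (f : B -> M) :=
  GRing.isLinear.Build K {malg K[B]} M *:%R (lin f) (lin_is_linear f).

Lemma linU (B : choiceType) (M : lmodType K) (f : B -> M) b : lin f << b >> = f b.
Proof.
by rewrite (lin_supp _ msuppU_le) big_seq_fset1 mcoeffUU scale1r.
Qed.

Lemma eq_lin (B : choiceType) (M : lmodType K) (f g : B -> M) : f =1 g ->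
  lin f =1 lin g.
Proof. by move=> fg x; apply: eq_bigr => b _; rewrite fg. Qed.

Lemma lin_id (B : choiceType) (x : {malg K[B]}) : lin (fun b => << b >>) x = x.
Proof.
rewrite [RHS]monalgE; apply: eq_bigr => b _; apply/malgP => b'.
by rewrite mcoeffZ !mcoeffU mulr_natr.
Qed.

Lemma malg_ext (B : choiceType) (M : lmodType K)
    (f g : {linear {malg K[B]} -> M}) :
  (forall b, f << b >> = g << b >>) -> f =1 g.
Proof.
move=> fg x; rewrite -(lin_id x) /lin !linear_sum; apply: eq_bigr => b _.
by rewrite !linearZ fg.
Qed.

Section Bilinear.
Variables (A B : choiceType) (M : lmodType K) (h : A -> B -> M).

Definition lin2 x y := lin (fun a => lin (h a) y) x.

(** The arguments are swapped so that linearity in the first one can be declared on a partial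
    application. *)
Definition lin2l y x := lin2 x y.

Lemma lin2_linearl y : linear (lin2l y).
Proof. by move=> c x x'; rewrite /lin2l /lin2 linearP. Qed.

Lemma lin2_linearr x : linear (lin2 x).
Proof.
move=> c y y'; rewrite /lin2 /lin scaler_sumr -big_split; apply: eq_bigr => a _.
rewrite -!/(lin _ _) linearP scalerDr !scalerA; congr (_ *: _ + _).
exact: mulrC.
Qed.

HB.instance Definition _ x :=
  GRing.isLinear.Build K {malg K[B]} M *:%R (lin2 x) (lin2_linearr x).
HB.instance Definition _ y :=
  GRing.isLinear.Build K {malg K[A]} M *:%R (lin2l y) (lin2_linearl y).

Lemma lin2UU a b : lin2 << a >> << b >> = h a b.
Proof. by rewrite /lin2 !linU. Qed.

Lemma lin2_suml I r (P : pred I) F y :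
  lin2 (\sum_(i <- r | P i) F i) y = \sum_(i <- r | P i) lin2 (F i) y.
Proof. exact: (linear_sum (lin2l y)). Qed.

Lemma lin2_sumr x I r (P : pred I) F :
  lin2 x (\sum_(i <- r | P i) F i) = \sum_(i <- r | P i) lin2 x (F i).
Proof. exact: linear_sum. Qed.

End Bilinear.

(** Linearity in each argument is a hypothesis rather than a structure, so that arbitrary composites
    can be compared; the proof packs the structures locally. *)
Lemma lin2_ext (A B : choiceType) (M : lmodType K)
    (f g : {malg K[A]} -> {malg K[B]} -> M) :
    (forall y, linear (f^~ y)) -> (forall x, linear (f x)) ->
    (forall y, linear (g^~ y)) -> (forall x, linear (g x)) ->
  (forall a b, f << a >> << b >> = g << a >> << b >>) -> forall x y, f x y = g x y.
Proof.
move=> fl fr gl gr fg x y.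
pose Fl y := GRing.isLinear.Build K {malg K[A]} M *:%R (f^~ y) (fl y).
pose Gl y := GRing.isLinear.Build K {malg K[A]} M *:%R (g^~ y) (gl y).
pose Fr x := GRing.isLinear.Build K {malg K[B]} M *:%R (f x) (fr x).
pose Gr x := GRing.isLinear.Build K {malg K[B]} M *:%R (g x) (gr x).
pose fL y : {linear {malg K[A]} -> M} := HB.pack (f^~ y) (Fl y).
pose gL y : {linear {malg K[A]} -> M} := HB.pack (g^~ y) (Gl y).
pose fR x : {linear {malg K[B]} -> M} := HB.pack (f x) (Fr x).
pose gR x : {linear {malg K[B]} -> M} := HB.pack (g x) (Gr x).
apply: (@malg_ext _ _ (fL y) (gL y)) => a.
by apply: (@malg_ext _ _ (fR << a >>) (gR << a >>)) => b; exact: fg.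
Qed.

Lemma tensE (A B : choiceType) (x : {malg K[A]}) (y : {malg K[B]}) :
  tens x y = lin2 (fun a b => << (a, b) >>) x y.
Proof. by []. Qed.

Lemma hmulE (B : choiceType) (H : hopf_ops K B) x y :
  hmul H x y = lin2 (hmulb H) x y.
Proof. by []. Qed.

Lemma hmul2_tens (B : choiceType) (H : hopf_ops K B) x y :
  hmul2 H (tens x y) = hmul H x y.
Proof.
rewrite /hmul2; apply: (lin2_ext (f := fun x y => lin _ (tens x y))) => //.
- by move=> v c u u'; rewrite !tensE -linearP /=; congr lin; apply: lin2_linearl.
- by move=> v c u u'; rewrite !tensE -linearP /=; congr lin; apply: lin2_linearr.
- exact: lin2_linearl.
- exact: lin2_linearr.
by move=> a b; rewrite tensE lin2UU linU.
Qed.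

(** [tens_map] uses only the values of [f] and [g] on basis elements, so for maps not known to be
    linear the right side carries their linear extensions. *)
Lemma tens_map_tens (A B A' B' : choiceType)
    (f : {malg K[A]} -> {malg K[A']}) (g : {malg K[B]} -> {malg K[B']}) x y :
  tens_map f g (tens x y) =
  tens (lin (fun a => f << a >>) x) (lin (fun b => g << b >>) y).
Proof.
rewrite /tens_map; apply: (lin2_ext (f := fun x y => lin _ (tens x y))
  (g := fun x y => tens (lin _ x) (lin _ y))) => //.
- by move=> v c u u'; rewrite !tensE -linearP /=; congr lin; apply: lin2_linearl.
- by move=> v c u u'; rewrite !tensE -linearP /=; congr lin; apply: lin2_linearr.
- by move=> v c u u'; rewrite !tensE linearP; apply: lin2_linearl.
- by move=> v c u u'; rewrite !tensE linearP; apply: lin2_linearr.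
by move=> a b; rewrite !tensE lin2UU !linU.
Qed.

Lemma tens_mapU (A B A' B' : choiceType)
    (f : {malg K[A]} -> {malg K[A']}) (g : {malg K[B]} -> {malg K[B']}) a b :
  tens_map f g << (a, b) >> = tens (f << a >>) (g << b >>).
Proof. exact: linU. Qed.

(** * Subspaces spanned by basis elements *)

Section Span.
Variables (B : choiceType) (P : pred B).
Implicit Types x y : {malg K[B]}.

Lemma span_ofP x : reflect (forall b, ~~ P b -> x@_b = 0) (span_of P x).
Proof.
apply: (iffP allP) => [H b nPb|H b bx].
  by apply: mcoeff_outdom; apply: contra nPb => /H.
by apply: contraTT bx => /H /eqP; rewrite mcoeff_eq0.
Qed.

Lemma span_of0 : span_of P (0 : {malg K[B]}).
Proof. by apply/span_ofP => b _; rewrite mcoeff0. Qed.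

Lemma span_ofU b : P b -> span_of P (<< b >> : {malg K[B]}).
Proof.
move=> Pb; apply/span_ofP => b' nPb'; rewrite mcoeffU.
by case: eqP nPb' => // <-; rewrite Pb.
Qed.

Lemma span_of_linear c x y : span_of P x -> span_of P y -> span_of P (c *: x + y).
Proof.
move=> /span_ofP xP /span_ofP yP; apply/span_ofP => b nPb.
by rewrite mcoeffD mcoeffZ xP // yP // mulr0 addr0.
Qed.

Lemma span_ofZ c x : span_of P x -> span_of P (c *: x).
Proof. by move=> xP; rewrite -[_ *: _]addr0; exact: span_of_linear xP span_of0. Qed.

Lemma span_ofD x y : span_of P x -> span_of P y -> span_of P (x + y).
Proof. by move=> xP yP; rewrite -[x]scale1r; exact: span_of_linear xP yP. Qed.

Lemma span_ofB x y : span_of P x -> span_of P y -> span_of P (x - y).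
Proof. by move=> xP yP; rewrite addrC -scaleN1r; exact: span_of_linear yP xP. Qed.

Lemma span_of_sum (I : eqType) r (Q : pred I) (F : I -> {malg K[B]}) :
  (forall i, i \in r -> Q i -> span_of P (F i)) ->
  span_of P (\sum_(i <- r | Q i) F i).
Proof.
move=> H; rewrite big_seq_cond; apply: (big_ind (fun z => is_true (span_of P z))) => [||i /andP[]].
- exact: span_of0.
- exact: span_ofD.
- exact: H.
Qed.

Lemma span_of_lin (C : choiceType) (Q : pred C) (f : C -> {malg K[B]})
    (x : {malg K[C]}) :
  span_of Q x -> (forall c, Q c -> span_of P (f c)) -> span_of P (lin f x).
Proof.
move=> /allP xQ H; apply: span_of_sum => c cx _; apply: span_ofZ.
by apply: H; exact: xQ.
Qed.

Section LinearOnSpan.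
Variables (M : lmodType K) (f : {malg K[B]} -> M).
Hypothesis fP : forall c : K, {in span_of P &, forall x y,
  f (c *: x + y) = c *: f x + f y}.

Lemma span_linear0 : f 0 = 0.
Proof.
have /eqP := fP 1 span_of0 span_of0.
by rewrite !scale1r addr0 addrC -subr_eq subrr eq_sym => /eqP.
Qed.

(** This is how antipodes are handled: they are constrained only on a span, and there their values
    on basis elements determine them. *)
Lemma span_linearE : {in span_of P, f =1 lin (fun b => f << b >>)}.
Proof.
move=> x /allP xP; rewrite -{1}(lin_id x) /lin.
(* The inclusion in [P] is carried through the induction so that every partial sum stays in the
   span, where [fP] applies. *)
have : {subset enum_fset (msupp x) <= P} by exact: xP.
elim: (enum_fset _) => [|b s IH] sP; first by rewrite !big_nil span_linear0.
rewrite !big_cons fP ?IH //.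
- by move=> b' b's; apply: sP; rewrite inE b's orbT.
- by apply: span_ofU; apply: sP; rewrite inE eqxx.
apply: span_of_sum => b' b's _; apply: span_ofZ; apply: span_ofU.
by apply: sP; rewrite inE b's orbT.
Qed.

End LinearOnSpan.

End Span.

Lemma span_of_predT (B : choiceType) (x : {malg K[B]}) : span_of predT x.
Proof. by apply/span_ofP. Qed.

(** Seeing [K] as a module over itself, by [K^o], makes the counit an instance of [lin]. *)
Lemma hcounit_lin (B : choiceType) (H : hopf_ops K B) x :
  hcounit H x = lin (hcounitb H : B -> K^o) x.
Proof. by []. Qed.

Lemma hcounitU (B : choiceType) (H : hopf_ops K B) b :
  hcounit H << b >> = hcounitb H b.
Proof. by rewrite hcounit_lin linU. Qed.

Lemma hcomulU (B : choiceType) (H : hopf_ops K B) b : hcomul H << b >> = hcomulb H b.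
Proof. exact: linU. Qed.

Lemma tens_map_sum (A B A' B' : choiceType)
    (f : {malg K[A]} -> {malg K[A']}) (g : {malg K[B]} -> {malg K[B']})
    I r (P : pred I) F :
  tens_map f g (\sum_(i <- r | P i) F i) = \sum_(i <- r | P i) tens_map f g (F i).
Proof. exact: linear_sum. Qed.

End FreeModuleTheory.

(** * Linear extensions of a forest *)

Lemma eq_rank_in s t : s =i t -> rank_in s =1 rank_in t.
Proof.
move=> st x; apply: perm_size; apply: uniq_perm; rewrite ?undup_uniq // => y.
by rewrite !mem_undup !mem_filter st.
Qed.

Lemma rank_in_packed s x : packed s -> x \in s -> rank_in s x = x.
Proof.
move=> /packedP[q sq]; rewrite sq => /andP[x0 xq].
rewrite -[RHS](size_iota 1 x); apply: perm_size; apply: uniq_perm.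
- exact: undup_uniq.
- exact: iota_uniq.
move=> y; rewrite mem_undup mem_filter mem_iota sq add1n ltnS.
case yx: (y <= x)%N; rewrite /= ?andbT ?andbF //.
by rewrite (leq_trans yx xq) andbT.
Qed.

Lemma pack_id s : packed s -> pack s = s.
Proof. by move=> ps; apply: map_id_in => x; exact: rank_in_packed. Qed.

Lemma pack_wordK s : pack_word (pack s) = pack_word s.
Proof. by apply/val_inj/pack_id/packed_pack. Qed.

Lemma pack_word_seq (w : pword) : pack_word w = w.
Proof. by apply/val_inj/pack_id; case: w. Qed.

Lemma size_pack s : size (pack s) = size s.
Proof. exact: size_map. Qed.

Lemma seq_lift (T U : eqType) (f : T -> U) (s : seq U) (D : pred T) :
  (forall y, y \in s -> exists2 x, D x & y = f x) ->
  exists2 s', all D s' & s = map f s'.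
Proof.
elim: s => [|y s IH] H; first by exists [::].
have [|s' Ds' ->] := IH; first by move=> z zs; apply: H; rewrite inE zs orbT.
have [x Dx ->] := H y (mem_head _ _).
by exists (x :: s') => //=; rewrite Dx.
Qed.

Section LinearExtensions.
Variables (V : finType) (F : pforest V).

(** A list from the leaves to the roots: a parent never precedes its child. Only edges between
    members of the list count, so on a subset of the vertices this is the condition for the induced
    subforest. *)
Definition linext (s : seq V) : bool :=
  pairwise (fun x y => parent F y != Some x) s.

Definition linexts (A : {set V}) : seq (seq V) :=
  [seq s <- permutations (enum A) | linext s].

Lemma mem_linexts A s :
  (s \in linexts A) = [&& uniq s, [set x in s] == A & linext s].
Proof.
rewrite mem_filter mem_permutations andbC andbA; congr (_ && _).
apply/idP/andP => [sA|[us /eqP <-]].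
  rewrite (perm_uniq sA) enum_uniq; split=> //; apply/eqP/setP => x.
  by rewrite inE (perm_mem sA) mem_enum.
by apply: uniq_perm; rewrite ?enum_uniq // => x; rewrite mem_enum inE.
Qed.

Lemma linexts_uniq A : uniq (linexts A).
Proof. by rewrite filter_uniq ?permutations_uniq. Qed.

Lemma linextsT_mem s x : s \in linexts setT -> x \in s.
Proof.
by rewrite mem_linexts => /and3P[_ /eqP/setP/(_ x)]; rewrite !inE.
Qed.

Lemma size_linexts A s : s \in linexts A -> size s = #|A|.
Proof.
by rewrite mem_filter mem_permutations cardE => /andP[_ /perm_size].
Qed.

Lemma linext_indexP s : uniq s ->
  reflect (forall v w, v \in s -> w \in s -> parent F v = Some w ->
             (index v s <= index w s)%N)
          (linext s).
Proof.
move=> us; case: s us => [|x0 s] us; first by apply: ReflectT.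
set t := x0 :: s in us *.
apply: (iffP (pairwiseP x0)) => [H v w vt wt e|H i j it jt ij].
  rewrite leqNgt; apply/negP => lt.
  have := H _ _ _ _ lt; rewrite !inE !index_mem => /(_ wt vt).
  by rewrite !nth_index // e eqxx.
apply/eqP => e; have := H _ _ _ _ e; rewrite !index_uniq //.
by rewrite !mem_nth // => /(_ isT isT); rewrite leqNgt ij.
Qed.

End LinearExtensions.

(** * [Phi] as a sum over linear extensions *)

Section PhiAsSum.
Variables (K : fieldType).

(** On a proper subset [A] the labels may have gaps; [pack_word] then does the renumbering that
    [restrict] performs on the labels. *)
Definition word_sum (V : finType) (F : pforest V) (A : {set V}) : {malg K[pword]} :=
  \sum_(s <- linexts F A) << pack_word (map (label F) s) >>.

Section Positions.
Variables (V : finType) (F : pforest V).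

Lemma packed_labels s : s \in linexts F setT -> packed (map (label F) s).
Proof.
move=> sF; have perm_s : perm_eq s (enum V).
  apply: uniq_perm; rewrite ?enum_uniq //.
    by move: sF; rewrite mem_linexts => /andP[].
  by move=> x; rewrite (linextsT_mem _ sF) mem_enum.
have [_ /packedP[q Hq]] := pforestP F; apply/packedP; exists q => j.
by rewrite -Hq; apply: perm_mem; exact: perm_map.
Qed.

(** [insubd] turns the index into an ordinal, with [enum_rank v] as a default that exists as soon as
    [v] does. On a list of all vertices the index is in range, see [positionE]. *)
Definition position (s : seq V) : {ffun V -> 'I_#|V|} :=
  [ffun v => insubd (enum_rank v) (index v s)].

Lemma positionE s v : s \in linexts F setT -> position s v = index v s :> nat.
Proof.
move=> sF; have lt : (index v s < #|V|)%N.
  by rewrite -cardsT -(size_linexts sF) index_mem (linextsT_mem _ sF).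
by rewrite ffunE val_insubd lt.
Qed.

Lemma position_inj : {in linexts F setT &, injective position}.
Proof.
move=> s t sF tF st; have ss := size_linexts sF; have st' := size_linexts tF.
case: s sF ss st => [|x0 s] sF ss st.
  by symmetry; apply: size0nil; rewrite st' -ss.
apply: (@eq_from_nth _ x0); rewrite ?ss ?st' // => i it.
set x := nth x0 _ i; have := congr1 (fun f : {ffun V -> 'I_#|V|} => val (f x)) st.
rewrite /= !positionE // index_uniq ?ss //; last first.
  by move: sF; rewrite mem_linexts => /andP[].
by move=> ->; rewrite nth_index // (linextsT_mem _ tF).
Qed.

(** The position function of a linear extension is automatically injective and compatible with the
    order, so only the condition on labels remains. *)
Lemma linearizations_position (tau : #|V|.-tuple 'I_#|V|.+1) s :
    s \in linexts F setT ->
  (position s \in linearizations F tau) = (map (label F) s == map val tau).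
Proof.
move=> sF; have ss := size_linexts sF.
have us : uniq s by move: sF; rewrite mem_linexts => /andP[].
have lab : [forall v, label F v == tnth tau (position s v)] =
           (map (label F) s == map val tau).
  apply/forallP/eqP => [H|H v].
    have ssV : size s = #|V| by rewrite ss cardsT.
    apply: (@eq_from_nth _ 0%N); rewrite !size_map ?size_tuple // => i it.
    (* A position [i] below [#|V|] provides the default vertex that [nth] requires. *)
    have x0 : V by apply: (@enum_val _ V (Ordinal (m := i) _)); rewrite -ssV.
    rewrite (nth_map x0) //; have /eqP-> := H (nth x0 s i).
    have ii : position s (nth x0 s i) = i :> nat by rewrite positionE // index_uniq.
    by rewrite (tnth_nth ord0) ii (nth_map ord0) // size_tuple -ssV.
  rewrite (tnth_nth ord0) positionE //.
  have vs : (index v s < size s)%N by rewrite index_mem (linextsT_mem _ sF).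
  rewrite -(nth_map _ 0%N val) -?H; last by rewrite size_tuple -cardsT -ss.
  by rewrite (nth_map v) // nth_index ?(linextsT_mem _ sF).
rewrite inE lab; case: (map _ s == _); rewrite ?andbF //=.
apply/andP; split.
  apply/injectiveP => v w /(congr1 val); rewrite /= !positionE //.
  by apply: (index_inj v); rewrite (linextsT_mem _ sF).
apply/forallP => v'; apply/forallP => v; apply/implyP => /connectP[p].
have /(linext_indexP _ us) H : linext F s by move: sF; rewrite mem_linexts => /and3P[].
(* The order condition is stated along paths and [linext] along edges; the inequalities are
   chained. *)
elim: p v' => [|w p IH] v' /=; first by move=> _ ->.
case/andP=> /eqP e pp l; apply: leq_trans (IH _ pp l).
by rewrite !positionE // H ?(linextsT_mem _ sF).
Qed.

(** [position] is a bijection from the extensions spelling [tau] onto the linearizations. *)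
Lemma card_linearizations (tau : #|V|.-tuple 'I_#|V|.+1) :
  #|linearizations F tau| =
  count (fun s => map (label F) s == map val tau) (linexts F setT).
Proof.
rewrite -size_filter cardE -(size_map position); apply: perm_size.
apply: uniq_perm; first exact: enum_uniq.
  rewrite map_inj_in_uniq; first exact: filter_uniq (linexts_uniq _ _).
  move=> s t.
  rewrite !(mem_filter _ _ (linexts _ _)) => /andP[_ sF] /andP[_ tF].
  exact: position_inj.
move=> phi; rewrite mem_enum; apply/idP/mapP => [phiF|[s]]; last first.
  by rewrite (mem_filter _ _ (linexts _ _)) => /andP[e sF] ->; rewrite linearizations_position.
have := phiF; rewrite inE => /and3P[/injectiveP phi_inj lab /forallP ord].
have [g phiK gK] : bijective phi by apply: inj_card_bij => //; rewrite card_ord.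
(* The inverse of [position]: the vertices listed in the order that [phi] assigns to them. *)
set s := map g (enum 'I_#|V|).
have is_ v : index v s = phi v.
  rewrite -[in LHS](phiK v) index_map ?index_enum_ord //; exact: can_inj gK.
have us : uniq s by rewrite map_inj_uniq ?enum_uniq //; exact: can_inj gK.
have sF : s \in linexts F setT.
  rewrite mem_linexts us /=; apply/andP; split.
    apply/eqP/setP => x; rewrite !inE; apply/mapP; exists (phi x) => //.
    by rewrite mem_enum.
  apply/(linext_indexP _ us) => v w _ _ e; rewrite !is_.
  have /forallP/(_ w)/implyP := ord v; apply.
  by apply: connect1; apply/eqP.
have pE : phi = position s by apply/ffunP => v; apply/val_inj; rewrite /= positionE.
exists s => //; rewrite (mem_filter _ _ (linexts _ _)) sF andbT -linearizations_position // -pE //.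
Qed.

(** Each extension spells a single word, which is packed, so after exchanging the two sums the inner
    one has exactly one term. *)
Lemma Phi_forestE : Phi_forest K F = word_sum F setT.
Proof.
rewrite /Phi_forest /word_sum.
transitivity (\sum_(s <- linexts F setT)
  \sum_(tau : #|V|.-tuple 'I_#|V|.+1 | packed (map val tau) &&
      (map (label F) s == map val tau)) (<< pack_word (map val tau) >> : {malg K[pword]})).
  rewrite [RHS](exchange_big_dep (fun tau : #|V|.-tuple 'I_#|V|.+1 =>
    packed (map val tau))) /=; last by move=> s tau _ /andP[].
  apply: eq_bigr => tau ptau; rewrite card_linearizations.
  under eq_bigl do rewrite ptau /=.
  by rewrite big_const_seq iter_addr_0 scaler_nat.
apply: eq_big_seq => s sF.
have ps := packed_labels sF.
(* The letters form an interval from 1 to [q], and [q] is at most the length [#|V|]; hence they fit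
   in ['I_#|V|.+1]. *)
have small x : x \in map (label F) s -> (x < #|V|.+1)%N.
  have [q Hq] := packedP _ ps; rewrite Hq ltnS => /andP[_ xq].
  apply: leq_trans xq _; rewrite -cardsT -(size_linexts sF) -(size_map (label F)).
  rewrite -{1}(size_iota 1 q); apply: uniq_leq_size (iota_uniq _ _) _ => z.
  by rewrite mem_iota add1n ltnS Hq.
have st : size (map (inord : nat -> 'I_#|V|.+1) (map (label F) s)) == #|V|.
  by rewrite !size_map (size_linexts sF) cardsT.
have vt : map val (Tuple st) = map (label F) s.
  by rewrite /= -map_comp; apply: map_id_in => x xs; rewrite /= inordK // small.
have [tau0 vt0] : exists tau0 : #|V|.-tuple 'I_#|V|.+1, map val tau0 = map (label F) s.
  by exists (Tuple st).
rewrite (big_pred1 tau0) ?vt0 // => tau /=; rewrite -vt0.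
apply/andP/eqP => [[_ /eqP /(inj_map val_inj) e]|->].
  exact/val_inj.
by rewrite vt0.
Qed.

End Positions.
End PhiAsSum.

(** * Induced subforests and isomorphism classes *)

Section Induced.
Variables (V W : finType) (F : pforest V) (G : pforest W) (f : V -> W).
Hypotheses (f_inj : injective f)
  (f_edge : forall v v', (parent G (f v) == Some (f v')) = (parent F v == Some v')).

Lemma linext_map s : linext G (map f s) = linext F s.
Proof. by rewrite /linext pairwise_map; apply: eq_pairwise => x y; rewrite /= f_edge. Qed.

(** Serves twice: for the inclusion of an induced subforest and for an isomorphism. *)
Lemma linexts_map (A : {set V}) : perm_eq (linexts G (f @: A)) (map (map f) (linexts F A)).
Proof.
apply: uniq_perm; first exact: linexts_uniq.
  by rewrite map_inj_uniq ?linexts_uniq //; exact: inj_map.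
move=> s; apply/idP/mapP => [|[s' + ->]]; rewrite !mem_linexts.
  case/and3P=> us /eqP sA ls.
  have [s' _ sE] : exists2 s', all (mem A) s' & s = map f s'.
    apply: seq_lift => y ys; have : y \in f @: A by rewrite -sA inE.
    by case/imsetP=> x; exists x.
  exists s' => //; move: us ls; rewrite mem_linexts sE linext_map map_inj_uniq //.
  move=> -> ->; rewrite andbT; apply/eqP/setP => x; rewrite inE.
  have := congr1 (fun B : {set W} => f x \in B) sA.
  by rewrite /= inE sE mem_map // mem_imset.
case/and3P=> us /eqP sA ls; rewrite map_inj_uniq // us linext_map ls andbT /=.
apply/eqP/setP => y; rewrite inE -sA.
by apply/mapP/imsetP => -[x xs ->]; exists x => //; move: xs; rewrite inE.
Qed.

End Induced.

Section Invariance.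
Variable K : fieldType.

(** Ranking the labels within [A], as [restrict] does, is the same as packing the word spelled by a
    list of all of [A], so the two sums agree extension by extension. *)
Lemma Phi_forest_restrict (V : finType) (F : pforest V) (A : {set V}) :
  Phi_forest K (restrict F A) = word_sum K F A.
Proof.
rewrite Phi_forestE /word_sum; set G := restrict F A.
have edgeE (v v' : {v | v \in A}) :
    (parent F (val v) == Some (val v')) = (parent G v == Some v').
  rewrite /parent /= ffunE /restrict_parent; case: (parent F _) => [w|] //=.
  case: insubP => [u _ <-|]; first by rewrite !(inj_eq Some_inj) (inj_eq val_inj).
  by move=> wA; apply/negbTE; apply: contra wA => /eqP[->]; exact: valP.
have AE : val @: [set: {v | v \in A}] = A.
  apply/setP => x; apply/imsetP/idP => [[v _ ->]|xA]; first exact: valP.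
  by exists (Sub x xA).
have := linexts_map val_inj edgeE setT; rewrite AE => lA.
rewrite [RHS](perm_big _ lA) big_map.
apply: eq_big_seq => s sG; rewrite -map_comp -[in RHS]pack_wordK.
congr (<< pack_word _ >>); rewrite /pack -map_comp; apply: eq_map => v.
rewrite /label /= ffunE; apply: eq_rank_in => j.
apply/mapP/mapP => -[u us ->]; exists u => //; first exact: linextsT_mem sG.
by rewrite mem_enum.
Qed.

(** Makes [Phi] independent of the representatives chosen by [frepr]. *)
Lemma Phi_forest_iso (V W : finType) (F : pforest V) (G : pforest W) :
  piso F G -> Phi_forest K F = Phi_forest K G.
Proof.
case/pisoP=> f [fb fp fl]; rewrite !Phi_forestE /word_sum.
have f_inj := bij_inj fb.
have edgeE v v' : (parent G (f v) == Some (f v')) = (parent F v == Some v').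
  by rewrite fp; case: (parent F v) => //= w; rewrite !(inj_eq Some_inj) inj_eq.
have -> : [set: W] = f @: setT.
  apply/setP => y; rewrite inE; case: fb => g _ gK; apply/esym/imsetP.
  by exists (g y).
rewrite [RHS](perm_big _ (linexts_map f_inj edgeE setT)) big_map.
apply: eq_bigr => s _; congr (<< pack_word _ >>); rewrite -map_comp.
by apply: eq_map => v; rewrite /= fl.
Qed.

End Invariance.

Lemma piso_transport (V : finType) (F : pforest V) : piso F (transport F).
Proof.
apply/pisoP; exists enum_rank; split; first by exists enum_val; [exact: enum_rankK|exact: enum_valK].
  by move=> v; rewrite /parent /= ffunE /transport_parent enum_rankK.
by move=> v; rewrite /label /= ffunE /transport_label enum_rankK.
Qed.

Lemma piso_frepr (V : finType) (F : pforest V) : piso (frepr (class_of F)) F.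
Proof.
apply: piso_trans (piso_sym (piso_transport F)).
apply/(pi_raw_eq (repr (class_of F)) (Tagged (fun n => pforest 'I_n) (transport F))).
exact: reprK.
Qed.

Lemma class_of_eq (V W : finType) (F : pforest V) (G : pforest W) :
  class_of F = class_of G <-> piso F G.
Proof.
split=> [e|FG].
  by apply: piso_trans (piso_frepr G); rewrite -e; apply/piso_sym/piso_frepr.
apply/pi_raw_eq => /=; apply: piso_trans (piso_transport G).
exact: piso_trans (piso_sym (piso_transport F)) FG.
Qed.

Lemma class_of_frepr (c : forest_class) : class_of (frepr c) = c.
Proof.
rewrite -[RHS]reprK; apply/pi_raw_eq; exact: piso_sym (piso_transport _).
Qed.

Lemma fsize_class_of (V : finType) (F : pforest V) : fsize (class_of F) = #|V|.
Proof.
have /pisoP[f [fb _ _]] := piso_frepr F.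
by rewrite -(bij_eq_card fb) card_ord.
Qed.

Lemma Phi_linear (K : fieldType) : linear (Phi K).
Proof. exact: lin_is_linear. Qed.
HB.instance Definition _ (K : fieldType) :=
  GRing.isLinear.Build K {malg K[forest_class]} {malg K[pword]} *:%R (Phi K)
    (@Phi_linear K).

Lemma PhiZ (K : fieldType) k x : Phi K (k *: x) = k *: Phi K x.
Proof. by rewrite linearZ. Qed.

Lemma PhiB (K : fieldType) x y : Phi K (x - y) = Phi K x - Phi K y.
Proof. by rewrite linearB. Qed.

Lemma Phi_sum (K : fieldType) I r (P : pred I) F :
  Phi K (\sum_(i <- r | P i) F i) = \sum_(i <- r | P i) Phi K (F i).
Proof. exact: linear_sum. Qed.

Lemma Phi_basis (K : fieldType) c : Phi K << c >> = Phi_forest K (frepr c).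
Proof. by rewrite /Phi linU. Qed.

Lemma PhiU (K : fieldType) (V : finType) (F : pforest V) :
  Phi K << class_of F >> = Phi_forest K F.
Proof. by rewrite Phi_basis; apply: Phi_forest_iso; exact: piso_frepr. Qed.

(** Along a path the inequalities on edges compose. Conversely, acyclicity makes a vertex different
    from its parent, so each edge is an instance of the heap condition. *)
Lemma heapP (V : finType) (F : pforest V) :
  reflect (forall v w, parent F v = Some w -> (label F w < label F v)%N) (heap F).
Proof.
have [ac _] := pforestP F.
apply: (iffP forallP) => [H v w e|H a].
  have /forallP/(_ w)/implyP := H v; apply.
  have eW : edge (parent F) v w by apply/eqP.
  rewrite andbC /above connect1 //=; apply: contraL eW => /eqP->; apply/negP => eW.
  move: ac => /forallP/(_ w)/forallP/(_ w)/implyP/(_ eW).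
  by rewrite /above connect0.
apply/forallP => b; apply/implyP => /andP[ab] /connectP[[|w p] /=].
  by move=> _ e; rewrite e eqxx in ab.
case/andP=> /eqP /H wa pp ->; apply: leq_ltn_trans wa.
elim: p w pp {ab} => [|x p IH] w //= /andP[/eqP /H xw /IH le].
exact: leq_trans le (ltnW xw).
Qed.

Lemma heap_iso (V W : finType) (F : pforest V) (G : pforest W) :
  piso F G -> heap F = heap G.
Proof.
suff H (V' W' : finType) (F' : pforest V') (G' : pforest W') :
    piso F' G' -> heap G' -> heap F'.
  by move=> i; apply/idP/idP; apply: H => //; exact: piso_sym.
case/pisoP=> f [_ fp fl] /heapP hG; apply/heapP => v w e.
by rewrite -!fl; apply: hG; rewrite fp e.
Qed.

Lemma heap_class_of (V : finType) (F : pforest V) : heap_class (class_of F) = heap F.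
Proof. exact/heap_iso/piso_frepr. Qed.

(** Renumbering by [rank_in] is strictly increasing on the labels that occur, so strict inequalities
    survive. *)
Lemma heap_restrict (V : finType) (F : pforest V) A : heap F -> heap (restrict F A).
Proof.
move=> /heapP hF; apply/heapP => v w; rewrite /parent /label /= !ffunE.
rewrite /restrict_parent /restrict_label; case e: (parent F _) => [u|] //=.
case: insubP => // u' _ uE [<-]; rewrite rank_in_mono ?uE ?hF //.
- by apply/mapP; exists u'; rewrite ?uE // mem_enum.
- by apply/mapP; exists v; rewrite // mem_enum.
Qed.

Lemma heap_union (V W : finType) (F : pforest V) (G : pforest W) :
  heap F -> heap G -> heap (union F G).
Proof.
move=> /heapP hF /heapP hG; apply/heapP => -[v|v] -[w|w];
  rewrite /parent /label /= !ffunE /=.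
- by case e: (parent F v) => [u|] //= [<-]; exact: hF.
- by case: (parent F v).
- by case: (parent G v).
- by case e: (parent G v) => [u|] //= [<-]; rewrite ltn_add2r; exact: hG.
Qed.

Lemma heap_empty : heap empty_forest.
Proof. by apply/heapP => -[]. Qed.

(** * Shuffles and disjoint unions *)

Section Shuffle.

(** A polymorphic form of [shuffles], for lists of vertices: these shuffles are pairwise distinct
    even when they spell the same word, so multiplicities of words become a count of lists. *)
Fixpoint shuffle (T : Type) (s : seq T) : seq T -> seq (seq T) :=
  if s is a :: s' then
    fix shuffle_s (t : seq T) : seq (seq T) :=
      if t is b :: t' then
        map (cons a) (shuffle s' t) ++ map (cons b) (shuffle_s t')
      else [:: s]
  else fun t => [:: t].

Lemma shuffles_map (T : Type) (f : T -> nat) s t :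
  shuffles (map f s) (map f t) = map (map f) (shuffle s t).
Proof.
elim: s t => [|a s IHs] //= t; elim: t => [|b t IHt] //=.
rewrite map_cat -!map_comp IHt (IHs (b :: t)) -!map_comp.
by congr (_ ++ _); apply: eq_map.
Qed.

Lemma shuffles_nil s : shuffles s [::] = [:: s].
Proof. by case: s. Qed.

Variables (V W : eqType).
Implicit Types (s : seq (V + W)).

Definition lefts s := pmap (fun x => if x is inl v then Some v else None) s.
Definition rights s := pmap (fun x => if x is inr w then Some w else None) s.

Lemma mem_map_cons (T : eqType) (a b : T) (s : seq T) (X : seq (seq T)) :
  (b :: s \in map (cons a) X) = (b == a) && (s \in X).
Proof.
apply/mapP/andP => [[t tX [-> ->]]|[/eqP-> sX]]; first by rewrite eqxx.
by exists s.
Qed.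

Lemma nil_map_cons (T : eqType) (a : T) (X : seq (seq T)) :
  ([::] \in map (cons a) X) = false.
Proof. by apply/mapP => -[]. Qed.

Lemma eq_map_inl (s1 : seq V) s :
  (s == map inl s1) = (lefts s == s1) && (rights s == [::]).
Proof.
elim: s s1 => [|[v|w] s IH] [|a s1] //=; rewrite ?andbF //.
by rewrite !eqseq_cons -andbA -IH.
Qed.

Lemma mem_shuffle (s1 : seq V) (s2 : seq W) s :
  (s \in shuffle (map inl s1) (map inr s2)) = (lefts s == s1) && (rights s == s2).
Proof.
elim: s1 s2 s => [|a s1 IHs1] s2 s.
  rewrite inE; elim: s s2 => [|[v|w] s IH] [|b s2] //=; rewrite ?andbF //.
  by rewrite !eqseq_cons IH andbCA.
elim: s2 s => [|b s2 IHs2] s; first by rewrite inE (eq_map_inl (a :: s1)).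
rewrite [shuffle _ _]/= mem_cat; case: s => [|[v|w] s].
- by rewrite !nil_map_cons.
- by rewrite !mem_map_cons /= orbF (IHs1 (b :: s2)) eqseq_cons andbA.
- by rewrite !mem_map_cons /= IHs2 !eqseq_cons andbCA.
Qed.

Lemma shuffle_uniq (s1 : seq V) (s2 : seq W) :
  uniq (shuffle (map inl s1) (map inr s2)).
Proof.
elim: s1 s2 => [|a s1 IHs1] s2 //; elim: s2 => [|b s2 IHs2] //.
rewrite [shuffle _ _]/= cat_uniq !map_inj_uniq ?(IHs1 (b :: s2)) ?IHs2 ?andbT //=;
  do ?by move=> x y [].
by apply/hasPn => x /mapP[y _ ->]; rewrite /= mem_map_cons.
Qed.

Lemma mem_lefts s v : (v \in lefts s) = (inl v \in s).
Proof. by elim: s => [|[x|x] s IH] //=; rewrite !inE IH. Qed.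

Lemma mem_rights s w : (w \in rights s) = (inr w \in s).
Proof. by elim: s => [|[x|x] s IH] //=; rewrite !inE IH. Qed.

Lemma uniq_lefts_rights s : uniq s = uniq (lefts s) && uniq (rights s).
Proof.
elim: s => [|[x|x] s IH] //=; first by rewrite IH mem_lefts andbA.
by rewrite IH mem_rights andbCA.
Qed.

End Shuffle.

Section Product.
Variables (V W : finType) (F : pforest V) (G : pforest W).

(** No edge joins the two parts of a disjoint union, so only letters from the same part constrain
    each other. *)
Lemma linext_union s :
  linext (union F G) s = linext F (lefts s) && linext G (rights s).
Proof.
have aL x t : all (fun y => parent (union F G) y != Some (inl x)) t =
    all (fun y => parent F y != Some x) (lefts t).
  elim: t => [|[y|y] t IH] //=; rewrite -IH /parent /= ffunE /=.
    by congr (~~ _ && _); case: ((pforest_val F).1 y).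
  by case: (parent G y).
have aR x t : all (fun y => parent (union F G) y != Some (inr x)) t =
    all (fun y => parent G y != Some x) (rights t).
  elim: t => [|[y|y] t IH] //=; rewrite -IH /parent /= ffunE /=.
    by case: (parent F y).
  by congr (~~ _ && _); case: ((pforest_val G).1 y).
rewrite /linext; elim: s => [|[x|x] s IH] //=; first by rewrite IH aL andbA.
by rewrite IH aR andbCA.
Qed.

Lemma mem_linexts_union s : (s \in linexts (union F G) setT) =
  (lefts s \in linexts F setT) && (rights s \in linexts G setT).
Proof.
rewrite !mem_linexts linext_union uniq_lefts_rights.
have -> : ([set x in s] == setT) =
    ([set x in lefts s] == setT) && ([set x in rights s] == setT).
  apply/eqP/andP => [H|[/eqP HF /eqP HG]].
    split; apply/eqP/setP => x; rewrite !inE ?mem_lefts ?mem_rights.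
      by have /setP/(_ (inl x)) := H; rewrite !inE.
    by have /setP/(_ (inr x)) := H; rewrite !inE.
  apply/setP => -[x|x]; rewrite !inE.
    by have /setP/(_ x) := HF; rewrite !inE mem_lefts.
  by have /setP/(_ x) := HG; rewrite !inE mem_rights.
by rewrite [X in _ && X]andbACA andbACA.
Qed.

(** An extension of the union is a shuffle of exactly one pair of extensions, its [lefts] and its
    [rights]. *)
Lemma big_linexts_union (M : nmodType) (g : seq (V + W) -> M) :
  \sum_(s <- linexts (union F G) setT) g s =
  \sum_(s1 <- linexts F setT) \sum_(s2 <- linexts G setT)
    \sum_(s <- shuffle (map inl s1) (map inr s2)) g s.
Proof.
pose pairs := [seq (s1, s2) | s1 <- linexts F setT, s2 <- linexts G setT].
pose sh (p : seq V * seq W) : seq (seq (V + W)) := shuffle (map inl p.1) (map inr p.2).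
transitivity (\sum_(p <- pairs) \sum_(s <- sh p) g s); last by rewrite big_allpairs.
rewrite -(big_allpairs_dep (h := fun _ s => s)).
apply: perm_big; apply: uniq_perm.
- exact: linexts_uniq.
- apply: allpairs_uniq_dep.
  + by apply: allpairs_uniq; rewrite ?linexts_uniq // => -[? ?] [? ?].
  + by move=> p _; exact: shuffle_uniq.
  + move=> _ _ /allpairsPdep[p [s [_ sp ->]]] /allpairsPdep[q [t [_ tq ->]]] /= st.
    move: sp tq; rewrite {}st !mem_shuffle => /andP[/eqP p1 /eqP p2] /andP[/eqP q1 /eqP q2].
    suff -> : p = q by [].
    by case: p q p1 p2 q1 q2 => [? ?] [? ?] /= <- <- <- <-.
move=> s; rewrite mem_linexts_union; apply/andP/allpairsPdep.
  case=> sF sG; exists (lefts s, rights s), s; split=> //.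
    by apply/allpairsP; exists (lefts s, rights s).
  by rewrite mem_shuffle !eqxx.
case=> p [t [/allpairsP[q [q1 q2 ->]] + ->]]; rewrite mem_shuffle /=.
by case/andP=> /eqP-> /eqP->.
Qed.

End Product.

(** * Product and coproduct *)

Section PhiProduct.
Variable K : fieldType.

Lemma Phi_forest_union (V W : finType) (F : pforest V) (G : pforest W) :
  Phi_forest K (union F G) = hmul (WQSymd K) (Phi_forest K F) (Phi_forest K G).
Proof.
rewrite !Phi_forestE /word_sum big_linexts_union hmulE lin2_suml.
apply: eq_big_seq => s1 s1F; rewrite lin2_sumr; apply: eq_big_seq => s2 s2G.
rewrite lin2UU /= /wq_mulb /= !pack_id ?(packed_labels s1F) ?(packed_labels s2G) //.
(* An extension lists every vertex once, so the shift read off the word is the one built into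
   [union_label]. *)
have -> : (\max_(y <- map (label F) s1) y = \max_v label F v)%N.
  rewrite big_map; apply: perm_big; apply: uniq_perm.
  - by move: s1F; rewrite mem_linexts => /andP[].
  - exact: index_enum_uniq.
  - by move=> v; rewrite (linextsT_mem _ s1F) mem_index_enum.
set m := (\max_v _)%N.
have -> : map (label F) s1 = map (label (union F G)) (map inl s1).
  by rewrite -map_comp; apply: eq_map => v; rewrite /label /= ffunE.
have -> : [seq (x + m)%N | x <- map (label G) s2] = map (label (union F G)) (map inr s2).
  by rewrite -!map_comp; apply: eq_map => v; rewrite /label /= ffunE.
by rewrite shuffles_map big_map.
Qed.

Lemma Phi_mul_basis c d :
  Phi K (hmul (Hpo K) << c >> << d >>) = hmul (WQSymd K) (Phi K << c >>) (Phi K << d >>).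
Proof.
have -> : hmul (Hpo K) << c >> << d >> =
    << class_of (union (frepr c) (frepr d)) >> by exact: lin2UU.
transitivity (Phi_forest K (union (frepr c) (frepr d))); first exact: PhiU.
transitivity (hmul (WQSymd K) (Phi_forest K (frepr c)) (Phi_forest K (frepr d))).
  exact: Phi_forest_union.
by rewrite -[Phi_forest K (frepr c)]Phi_basis -[Phi_forest K (frepr d)]Phi_basis.
Qed.

Lemma Phi_mul x y : Phi K (hmul (Hpo K) x y) = hmul (WQSymd K) (Phi K x) (Phi K y).
Proof.
apply: (lin2_ext (f := fun x y => Phi K (hmul (Hpo K) x y))
                 (g := fun x y => hmul (WQSymd K) (Phi K x) (Phi K y))).
- by move=> v c u u'; rewrite !hmulE -linearP; congr (Phi K _); apply: lin2_linearl.
- by move=> v c u u'; rewrite !hmulE -linearP; congr (Phi K _); apply: lin2_linearr.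
- by move=> v c u u'; rewrite !hmulE linearP; apply: lin2_linearl.
- by move=> v c u u'; rewrite !hmulE linearP; apply: lin2_linearr.
exact: Phi_mul_basis.
Qed.

(** With [Hpo_hmulr1], evaluates the term of the cut at all the roots in the two antipode
    recursions, where the right factor is the unit. *)
Lemma WQSymd_hmulr1 x : hmul (WQSymd K) x (hunit (WQSymd K)) = x.
Proof.
rewrite -[RHS]lin_id hmulE /lin2; apply: eq_lin => w; rewrite linU /= /wq_mulb.
by rewrite shuffles_nil big_seq1 pack_word_seq.
Qed.

Lemma piso_union_empty (V W : finType) (F : pforest V) (G : pforest W) :
  #|W| = 0%N -> piso (union F G) F.
Proof.
move=> W0; have noW (w : W) : False by have := fintype0 w W0.
apply/piso_sym/pisoP; exists inl; split.
- by exists (fun x => match x with inl v => v | inr w => False_rect _ (noW w) end) => // -[v|w] //;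
   case: (noW w).
- by move=> v; rewrite /parent /= ffunE.
- by move=> v; rewrite /label /= ffunE.
Qed.

Lemma Hpo_hmulr1 x : hmul (Hpo K) x (hunit (Hpo K)) = x.
Proof.
rewrite -[RHS]lin_id hmulE /lin2; apply: eq_lin => c; rewrite linU /= /po_mulb.
congr << _ >>; rewrite -[RHS]class_of_frepr; apply/class_of_eq.
apply: piso_union_empty; rewrite card_ord fsize_class_of.
by apply: eq_card0 => -[].
Qed.

End PhiProduct.

(** * Admissible cuts and sets of vertices closed upwards *)

Section UpperSets.
Variables (V : finType) (F : pforest V).
Local Notation abv := (above (parent F)).

(** These are the possible sets of first letters of a linear extension. *)
Definition upper (A : {set V}) : bool :=
  [forall v, forall w, (w \in A) && (parent F v == Some w) ==> (v \in A)].

Lemma upperP (A : {set V}) : reflect (forall v w, w \in A -> parent F v = Some w -> v \in A) (upper A).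
Proof.
apply: (iffP forallP) => [H v w wA e|H v].
  by have /forallP/(_ w) := H v; rewrite wA e eqxx.
by apply/forallP => w; apply/implyP => /andP[wA /eqP]; exact: H.
Qed.

Lemma above_upper (A : {set V}) v w : upper A -> w \in A -> abv v w -> v \in A.
Proof.
move=> /upperP uA wA /connectP[p]; elim: p v => [|x p IH] v /=; first by move=> _ <-.
by case/andP=> /eqP e pp l; apply: uA e; exact: IH.
Qed.

(** Children precede parents, so a prefix contains the children of its members. Conversely, if it
    does, no vertex of the second list has its parent in the first, and the concatenation is an
    extension. *)
Lemma linexts_cat s1 s2 : (s1 ++ s2 \in linexts F setT) =
  [&& upper [set x in s1], s1 \in linexts F [set x in s1]
    & s2 \in linexts F (~: [set x in s1])].
Proof.
rewrite !mem_linexts /linext pairwise_cat cat_uniq eqxx.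
apply/and3P/and3P => [[/and3P[u1 /hasPn d u2] /eqP eT /and3P[/allrelP a p1 p2]]|].
  have eC : [set x in s2] = ~: [set x in s1].
    apply/setP => x; rewrite !inE; have /setP/(_ x) := eT; rewrite !inE mem_cat.
    by case x2 : (x \in s2); [move/d: x2 => /= /negbTE->|rewrite orbF => ->].
  rewrite u1 p1 u2 p2 eC eqxx; split=> //; apply/upperP => v w.
  rewrite inE => w1 e; apply/contraT => v1.
  have /(a _ _ w1)/eqP : v \in s2; last by rewrite e.
  by have /setP/(_ v) := eC; rewrite in_setC v1 inE.
case=> /upperP up /and3P[u1 _ p1] /and3P[u2 /eqP eC p2].
have e2 x : (x \in s2) = (x \notin s1) by have /setP/(_ x) := eC; rewrite !inE.
split; first by rewrite u1 u2 andbT; apply/hasPn => x; rewrite e2.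
  by apply/eqP/setP => x; rewrite !inE mem_cat e2 orbN.
rewrite p1 p2 !andbT; apply/allrelP => w v w1 v2; apply/eqP => e.
by have := up v w; rewrite !inE -[v \in s1]negbK -e2 v2 => /(_ w1 e).
Qed.

(** A cut position in an extension corresponds to a closed set with an extension of each side: the
    set consists of the letters before the cut, and its size gives the position back. *)
Lemma big_linexts_split (M : nmodType) (g : seq V -> seq V -> M) :
  \sum_(s <- linexts F setT) \sum_(i < (size s).+1) g (take i s) (drop i s) =
  \sum_(A | upper A) \sum_(s1 <- linexts F A) \sum_(s2 <- linexts F (~: A)) g s1 s2.
Proof.
pose prs (A : {set V}) := [seq (s1, s2) | s1 <- linexts F A, s2 <- linexts F (~: A)].
have mem_prs A p : p \in prs A -> A = [set x in p.1].
  case/allpairsP=> q [+ _ ->]; rewrite mem_linexts => /and3P[_ /eqP-> _] //.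
transitivity (\sum_(A <- enum upper) \sum_(p <- prs A) g p.1 p.2); last first.
  by rewrite big_enum; apply: eq_bigr => A _; rewrite big_allpairs.
rewrite -(big_allpairs_dep (h := fun _ p => p) (F := fun p => g p.1 p.2)).
(* All extensions have length [#|V|], so the cut positions form one fixed list. *)
transitivity (\sum_(s <- linexts F setT) \sum_(i <- iota 0 #|V|.+1)
    g (take i s) (drop i s)).
  apply: eq_big_seq => s sF; rewrite (size_linexts sF) cardsT.
  by rewrite -(big_mkord xpredT (fun i => g (take i s) (drop i s))) /index_iota subn0.
rewrite -(big_allpairs_dep (h := fun s i => (take i s, drop i s))
  (F := fun p => g p.1 p.2)).
apply: perm_big; apply: uniq_perm.
- apply: allpairs_uniq_dep; first exact: linexts_uniq.
    by move=> s _; exact: iota_uniq.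
  move=> _ _ /allpairsPdep[s [i [sF iV ->]]] /allpairsPdep[t [j [tF jV ->]]] /= [e1 e2].
  have st : s = t by rewrite -(cat_take_drop i s) e1 e2 cat_take_drop.
  rewrite -{}st in e1 e2 tF *; congr (Tagged _ _).
  move: iV jV; rewrite !mem_iota !add0n !ltnS -cardsT -(size_linexts sF) /= => iV jV.
  by have := congr1 size e1; rewrite !size_takel.
- apply: allpairs_uniq_dep; first exact: enum_uniq.
    move=> A _; apply: allpairs_uniq; rewrite ?linexts_uniq // => -[? ?] [? ?] //.
  move=> _ _ /allpairsPdep[A [p [_ pA ->]]] /allpairsPdep[B [q [_ qB ->]]] /= pq.
  by rewrite -{}pq in qB *; rewrite (mem_prs _ _ pA) (mem_prs _ _ qB).
move=> p; apply/allpairsPdep/allpairsPdep.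
  case=> s [i [sF _ ->]]; exists [set x in take i s], (take i s, drop i s).
  move: sF; rewrite -{1}(cat_take_drop i s) linexts_cat => /and3P[up s1 s2].
  split=> //; first by rewrite mem_enum.
  by apply/allpairsP; exists (take i s, drop i s).
case=> A [q [+ qA ->]]; rewrite mem_enum => up.
have AE := mem_prs _ _ qA; case/allpairsP: qA AE => r [+ + ->] /= AE.
move=> r1 r2; have rF : r.1 ++ r.2 \in linexts F setT.
  by rewrite linexts_cat -AE r1 r2 !andbT; exact: up.
exists (r.1 ++ r.2), (size r.1); rewrite take_size_cat // drop_size_cat //.
split; [exact: rF| |by []].
change (size r.1 \in iota 0 #|V|.+1); rewrite mem_iota add0n ltnS -cardsT -(size_linexts rF) size_cat.
exact: leq_addr.
Qed.

(** The roots of the subforest induced on [A]; on closed sets this inverts [above_cut]. *)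
Definition cut_of (A : {set V}) : {set V} :=
  [set v in A | if parent F v is Some w then w \notin A else true].

Lemma above_parent v u : abv v u -> v != u ->
  exists2 w, parent F v = Some w & abv w u.
Proof.
case/connectP=> [[|w p] /=]; first by move=> _ ->; rewrite eqxx.
by case/andP=> /eqP e pp l _; exists w => //; apply/connectP; exists p.
Qed.

Lemma parent_not_above v w : parent F v = Some w -> ~~ abv w v.
Proof.
have [/forallP/(_ v)/forallP/(_ w)/implyP ac _] := pforestP F.
by move=> /eqP /ac.
Qed.

Lemma above_refl v : abv v v.
Proof. exact: connect0. Qed.

Lemma above_trans u v w : abv u v -> abv v w -> abv u w.
Proof. exact: connect_trans. Qed.

Lemma parent_above v w : parent F v = Some w -> abv v w.
Proof. by move=> e; apply: connect1; apply/eqP. Qed.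

(** From a vertex of [A], follow parents as long as they stay in [A]: the last vertex reached
    belongs to the cut. *)
Lemma above_cut_of A : upper A -> above_cut F (cut_of A) = A.
Proof.
move=> uA; apply/setP => x; rewrite inE; apply/existsP/idP => [[v]|].
  by rewrite inE => /andP[/andP[vA _]]; exact: above_upper.
(* The measure is the number of vertices on the way from [x] to its root; by acyclicity it drops on
   passing to the parent. *)
have [n] := ubnP #|[set y | abv x y]|; elim: n x => // n IH x lt xA.
have [xb|] := boolP (x \in cut_of A); first by exists x; rewrite xb above_refl.
rewrite inE xA /=; case e: (parent F x) => [w|] //; rewrite negbK => wA.
have [|v /andP[vc wv]] := IH w _ wA.
  rewrite -ltnS; apply: leq_trans lt; rewrite ltnS; apply: proper_card.
  apply/properP; split; last by exists x; rewrite inE ?above_refl ?parent_not_above.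
  by apply/subsetP => y; rewrite !inE; apply: above_trans (parent_above e).
by exists v; rewrite vc; apply: above_trans (parent_above e) wv.
Qed.

Lemma upper_above_cut c : upper (above_cut F c).
Proof.
apply/upperP => v w; rewrite !inE => /existsP[u /andP[uc wu]] e.
by apply/existsP; exists u; rewrite uc; apply: above_trans (parent_above e) wu.
Qed.

Lemma mem_above_cut (c : {set V}) v : v \in c -> v \in above_cut F c.
Proof. by move=> vc; rewrite inE; apply/existsP; exists v; rewrite vc above_refl. Qed.

(** A vertex of [c] fails to be a root of the part above the cut exactly when its parent also lies
    above some vertex of [c], which is what admissibility excludes. *)
Lemma cut_of_above_cut c : (cut_of (above_cut F c) == c) = admissible F c.
Proof.
apply/eqP/idP => [cE|adm].
  apply/forall_inP => a ac; apply/forall_inP => b bc; apply/implyP => ab.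
  apply/negP => /above_parent/(_ ab)[w e wb].
  move: ac; rewrite -cE inE e => /andP[_ /negP]; apply; rewrite inE.
  by apply/existsP; exists b; rewrite bc.
apply/setP => v; rewrite [in LHS]inE; apply/andP/idP => [[]|vc].
  rewrite [in X in X -> _]inE => /existsP[u /andP[uc vu]].
  have [->//|vu'] := eqVneq v u; have [w -> wu] := above_parent vu vu'.
  by case/negP; rewrite inE; apply/existsP; exists u; rewrite uc.
split; first exact: mem_above_cut.
case e: (parent F v) => [w|] //; apply/negP; rewrite inE => /existsP[u /andP[uc wu]].
have vu := above_trans (parent_above e) wu.
move: adm => /forall_inP/(_ v vc)/forall_inP/(_ u uc)/implyP; rewrite vu /=.
have [uv|_ /(_ isT) //] := eqVneq v u.
by move: wu; rewrite -uv (negbTE (parent_not_above e)).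
Qed.

Lemma big_admissible (M : nmodType) (g : {set V} -> M) :
  \sum_(c | admissible F c) g (above_cut F c) = \sum_(A | upper A) g A.
Proof.
rewrite [RHS](reindex_onto (above_cut F) cut_of) /=; last exact: above_cut_of.
by apply: eq_bigl => c; rewrite upper_above_cut cut_of_above_cut.
Qed.

End UpperSets.

Section PhiCoproduct.
Variable K : fieldType.

Lemma Phi_Lea (V : finType) (F : pforest V) c :
  Phi K << Lea F c >> = word_sum K F (above_cut F c).
Proof. exact: etrans (PhiU _ _) (Phi_forest_restrict _ _ _). Qed.

Lemma Phi_Roo (V : finType) (F : pforest V) c :
  Phi K << Roo F c >> = word_sum K F (~: above_cut F c).
Proof. exact: etrans (PhiU _ _) (Phi_forest_restrict _ _ _). Qed.

(** Deconcatenating a word cuts the extension that spells it; the closed sets that arise are those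
    above the admissible cuts, and the two sides spell the words of [Lea] and [Roo]. *)
Lemma Phi_forest_comul (V : finType) (F : pforest V) :
  hcomul (WQSymd K) (Phi_forest K F) =
  \sum_(c : {set V} | admissible F c)
    tens (Phi K << Lea F c >>) (Phi K << Roo F c >>).
Proof.
rewrite Phi_forestE /word_sum /hcomul linear_sum /=.
transitivity (\sum_(s <- linexts F setT) \sum_(i < (size s).+1)
  (<< (pack_word (map (label F) (take i s)), pack_word (map (label F) (drop i s))) >> :
   {malg K[(pword * pword)%type]})).
  apply: eq_big_seq => s sF; rewrite linU /= /wq_comulb.
  rewrite /= pack_id ?(packed_labels sF) // size_map.
  by apply: eq_bigr => i _; rewrite map_take map_drop.
rewrite (big_linexts_split F (fun s1 s2 =>
  << (pack_word (map (label F) s1), pack_word (map (label F) s2)) >>)).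
rewrite -big_admissible; apply: eq_bigr => c _.
symmetry; apply: etrans (congr2 (@tens K _ _) (Phi_Lea F c) (Phi_Roo F c)) _.
rewrite tensE lin2_suml; apply: eq_bigr => s1 _.
by rewrite lin2_sumr; apply: eq_bigr => s2 _; rewrite lin2UU.
Qed.

Lemma Phi_comul_basis c : hcomul (WQSymd K) (Phi K << c >>) =
  \sum_(v | admissible (frepr c) v)
    tens (Phi K << Lea (frepr c) v >>) (Phi K << Roo (frepr c) v >>).
Proof. exact: etrans (congr1 _ (Phi_basis K c)) (Phi_forest_comul _). Qed.

Lemma Phi_comul x :
  hcomul (WQSymd K) (Phi K x) = tens_map (Phi K) (Phi K) (hcomul (Hpo K) x).
Proof.
apply: (@malg_ext _ _ _ (lin (wq_comulb K) \o Phi K)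
  (lin _ \o lin (@po_comulb K))) => c.
apply: etrans (Phi_comul_basis c) _; symmetry.
apply: etrans (congr1 (tens_map _ _) (hcomulU (Hpo K) c)) _.
rewrite /= /po_comulb tens_map_sum.
by apply: eq_bigr => v _; rewrite tens_mapU.
Qed.

End PhiCoproduct.

(** * Antipodes *)

Lemma piso_empty (V W : finType) (F : pforest V) (G : pforest W) :
  #|V| = 0%N -> #|W| = 0%N -> piso F G.
Proof.
move=> V0 W0; have noV (v : V) : False by have := fintype0 v V0.
have noW (w : W) : False by have := fintype0 w W0.
apply/pisoP; exists (fun v => False_rect W (noV v)); split=> [|v|v].
- by exists (fun w => False_rect V (noW w)) => [v|w]; [case: (noV v)|case: (noW w)].
- by case: (noV v).
- by case: (noV v).
Qed.

Lemma restrict_full (V : finType) (F : pforest V) (A : {set V}) :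
  A = setT -> piso (restrict F A) F.
Proof.
move=> AT; have inA v : v \in A by rewrite AT inE.
apply/pisoP; exists val; split.
- by exists (fun v => Sub v (inA v)) => v //; exact/val_inj.
- move=> v; rewrite /parent /= ffunE /restrict_parent /parent /=.
  by case: ((pforest_val F).1 (val v)) => //= w; rewrite insubT.
move=> v; rewrite /label /= ffunE /restrict_label.
have eqc : [seq label F (val u) | u : {v | v \in A}] =i codom (label F).
  move=> j; apply/mapP/codomP => [[u _ ->]|[u ->]]; first by exists (val u).
  by exists (Sub u (inA u)); rewrite ?mem_enum.
rewrite (eq_rank_in eqc) rank_in_packed ?codom_f //.
by have [] := pforestP F.
Qed.

Section TotalCut.
Variables (V : finType) (F : pforest V).

(** The cut at all the roots. Its term in the coproduct is the forest tensor the unit, the term that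
    the antipode recursions isolate. *)
Definition root_cut : {set V} := cut_of F setT.

Lemma above_root_cut : above_cut F root_cut = setT.
Proof. by apply: above_cut_of; apply/upperP => v w _ _; rewrite inE. Qed.

Lemma admissible_root_cut : admissible F root_cut.
Proof. by rewrite -cut_of_above_cut above_root_cut. Qed.

Lemma Lea_root_cut : Lea F root_cut = class_of F.
Proof. by apply/class_of_eq/restrict_full/above_root_cut. Qed.

Lemma Roo_root_cut : Roo F root_cut = class_of empty_forest.
Proof.
apply/class_of_eq/piso_empty; last by apply: eq_card0 => -[].
by rewrite card_sig above_root_cut; apply: eq_card0 => x; rewrite !inE.
Qed.

Lemma fsize_Lea c : fsize (Lea F c) = #|above_cut F c|.
Proof. by rewrite fsize_class_of card_sig; apply: eq_card => x; rewrite inE. Qed.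

(** An admissible cut is determined by the set above it, so only [root_cut] has every vertex above
    it. *)
Lemma fsize_Lea_lt c : admissible F c -> c != root_cut -> (fsize (Lea F c) < #|V|)%N.
Proof.
move=> adm cr; rewrite fsize_Lea -cardsT; apply: proper_card.
rewrite properE subsetT /= subTset; apply: contra cr => /eqP cT.
by rewrite -(eqP (_ : cut_of F (above_cut F c) == c)) ?cut_of_above_cut // cT.
Qed.

Lemma heap_Lea c : heap F -> heap_class (Lea F c).
Proof. by move=> hF; rewrite heap_class_of heap_restrict. Qed.

Lemma heap_Roo c : heap F -> heap_class (Roo F c).
Proof. by move=> hF; rewrite heap_class_of heap_restrict. Qed.

End TotalCut.

(** * Unit, counit and grading *)

Section UnitCounit.
Variable K : fieldType.

Lemma Phi_forest_empty (V : finType) (F : pforest V) :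
  #|V| = 0%N -> Phi_forest K F = hunit (WQSymd K).
Proof.
move=> V0; have noV (v : V) : False by have := fintype0 v V0.
have s0 (s : seq V) : s = [::] by case: s => // v; case: (noV v).
rewrite Phi_forestE /word_sum (perm_big [:: [::]]) ?big_seq1 //.
apply: uniq_perm; rewrite ?linexts_uniq // => s; rewrite (s0 s) mem_linexts inE eqxx /=.
by rewrite andbT; apply/eqP/setP => v; case: (noV v).
Qed.

Lemma Phi_unit : Phi K (hunit (Hpo K)) = hunit (WQSymd K).
Proof.
apply: etrans (PhiU K empty_forest) _; apply: Phi_forest_empty.
by apply: eq_card0 => -[].
Qed.

Lemma word_sum_homogeneous (V : finType) (F : pforest V) n :
  #|V| = n -> homogeneous (WQSymd K) n (word_sum K F setT).
Proof.
move=> <-; apply: span_of_sum => s sF _; apply: span_ofU.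
by rewrite /= size_pack size_map (size_linexts sF) cardsT.
Qed.

Lemma Phi_graded n x : homogeneous (Hpo K) n x -> homogeneous (WQSymd K) n (Phi K x).
Proof.
move=> xn; apply: span_of_lin xn _ => c /eqP cn.
by rewrite Phi_forestE; apply: word_sum_homogeneous; rewrite card_ord.
Qed.

Lemma Phi_counit_basis c :
  hcounit (WQSymd K) (Phi K << c >>) = hcounit (Hpo K) << c >>.
Proof.
rewrite [RHS]hcounitU /=; apply: etrans (congr1 (hcounit _) (Phi_basis K c)) _.
have [c0|c0] := eqVneq (fsize c) 0%N.
  by rewrite (Phi_forest_empty (frepr c)) ?card_ord // /hunit hcounitU.
rewrite Phi_forestE /word_sum hcounit_lin linear_sum big_seq big1 // => s sF.
apply: etrans (linU _ _) _.
rewrite /= size_pack size_map (size_linexts sF) cardsT card_ord.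
by rewrite (negbTE c0).
Qed.

Lemma Phi_counit x : hcounit (WQSymd K) (Phi K x) = hcounit (Hpo K) x.
Proof.
pose fW := lin (hcounitb (WQSymd K) : pword -> K^o).
pose fH := lin (hcounitb (Hpo K) : forest_class -> K^o).
apply: (@malg_ext K _ K^o (fW \o Phi K) fH) => c.
exact: Phi_counit_basis.
Qed.

End UnitCounit.

Section Antipode.
Variable K : fieldType.

Lemma big_admissibleD1 (M : nmodType) (V : finType) (F : pforest V) (f : {set V} -> M) :
  \sum_(v | admissible F v) f v =
  f (root_cut F) + \sum_(v | admissible F v && (v != root_cut F)) f v.
Proof. by rewrite (bigD1 (root_cut F)) // admissible_root_cut. Qed.

(** The left antipode identity, with the term of [root_cut] isolated. In the remaining terms [S] is
    applied to smaller forests only. *)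
Lemma antipode_rec (P : pred forest_class) S c :
    is_antipode_on (Hpo K) P S -> P c ->
  S << c >> = hcounit (Hpo K) << c >> *: hunit (Hpo K) -
    \sum_(v | admissible (frepr c) v && (v != root_cut (frepr c)))
      hmul (Hpo K) (S << Lea (frepr c) v >>) << Roo (frepr c) v >>.
Proof.
move=> aS Pc; have cP := span_ofU K Pc.
rewrite -(antipode_left aS cP); apply/eqP; rewrite eq_sym subr_eq; apply/eqP.
have -> : hmul2 (Hpo K) (tens_map S id (hcomul (Hpo K) << c >>)) =
    \sum_(v | admissible (frepr c) v)
      hmul (Hpo K) (S << Lea (frepr c) v >>) << Roo (frepr c) v >>.
  apply: etrans (congr1 (fun z => hmul2 _ (tens_map S id z)) (hcomulU (Hpo K) c)) _.
  rewrite /= /po_comulb tens_map_sum /hmul2 linear_sum; apply: eq_bigr => v _.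
  by rewrite tens_mapU; exact: hmul2_tens.
rewrite big_admissibleD1; congr (_ + _).
apply: etrans (congr2 (fun a b => hmul (Hpo K) (S << a >>) << b >>)
  (etrans (Lea_root_cut (frepr c)) (class_of_frepr c)) (Roo_root_cut (frepr c))) _.
exact: Hpo_hmulr1.
Qed.

(** The coproduct of [Phi K << c >>] is a sum over the cuts of [c], so [T] satisfies on the image a
    recursion of the same shape as [antipode_rec]. *)
Lemma antipode_Phi_rec T c :
    is_antipode_on (WQSymd K) predT T ->
  T (Phi K << c >>) = hcounit (WQSymd K) (Phi K << c >>) *: hunit (WQSymd K) -
    \sum_(v | admissible (frepr c) v && (v != root_cut (frepr c)))
      hmul (WQSymd K) (T (Phi K << Lea (frepr c) v >>)) (Phi K << Roo (frepr c) v >>).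
Proof.
move=> aT; have PT x : x \in span_of (K := K) (predT : pred pword) by exact: span_of_predT.
(* The span of [predT] is everything, so [T] is its own linear extension; this removes the [lin]
   that [tens_map_tens] introduces. *)
have TE := span_linearE (antipode_linear aT).
rewrite -(antipode_left aT (PT _)); apply/eqP; rewrite eq_sym subr_eq; apply/eqP.
have -> : hmul2 (WQSymd K) (tens_map T id (hcomul (WQSymd K) (Phi K << c >>))) =
    \sum_(v | admissible (frepr c) v)
      hmul (WQSymd K) (T (Phi K << Lea (frepr c) v >>)) (Phi K << Roo (frepr c) v >>).
  apply: etrans (congr1 (fun z => hmul2 _ (tens_map T id z)) (Phi_comul_basis K c)) _.
  rewrite tens_map_sum /hmul2 linear_sum; apply: eq_bigr => v _.
  apply: etrans (congr1 _ (tens_map_tens _ _ _ _)) _.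
  by apply: etrans (hmul2_tens _ _ _) _; rewrite lin_id -TE.
rewrite big_admissibleD1; congr (_ + _).
apply: etrans (congr2 (fun a b => hmul (WQSymd K) (T (Phi K << a >>)) (Phi K << b >>))
  (etrans (Lea_root_cut (frepr c)) (class_of_frepr c)) (Roo_root_cut (frepr c))) _.
exact: etrans (congr1 _ (Phi_unit K)) (WQSymd_hmulr1 _).
Qed.

(** The two recursions match term by term, by induction on the number of vertices; the heap
    condition passes to [Lea], so the induction stays where [S] is an antipode. *)
Lemma Phi_antipode_basis S T c :
    is_antipode_on (Hpo K) heap_class S -> is_antipode_on (WQSymd K) predT T ->
  heap_class c -> Phi K (S << c >>) = T (Phi K << c >>).
Proof.
move=> aS aT; have [n] := ubnP (fsize c); elim: n c => // n IH c lt hc.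
apply: etrans (congr1 (Phi K) (antipode_rec aS hc)) _.
apply: etrans _ (esym (antipode_Phi_rec c aT)).
apply: etrans (PhiB _ _) _; apply: (congr2 (fun a b => a - b)).
  apply: etrans (PhiZ _ _) _.
  congr (_ *: _); [exact: esym (Phi_counit_basis K c)|exact: Phi_unit].
apply: etrans (Phi_sum _ _ _) _.
apply: eq_bigr => v /andP[adm vr]; apply: etrans (Phi_mul _ _) _.
congr (hmul _ _ _); apply: IH; last exact: heap_Lea.
by have := fsize_Lea_lt adm vr; rewrite card_ord => /leq_trans; apply.
Qed.

Lemma Phi_antipode S T :
    is_antipode_on (Hpo K) heap_class S -> is_antipode_on (WQSymd K) predT T ->
  {in Hhpo K, forall x, Phi K (S x) = T (Phi K x)}.
Proof.
move=> aS aT x xh.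
have PSE := span_linearE (P := heap_class) (f := fun x => Phi K (S x)).
have TPE := span_linearE (P := heap_class) (f := fun x => T (Phi K x)).
rewrite (PSE _ x xh); last first.
  by move=> k u v uh vh; rewrite (antipode_linear aS) ?linearP.
rewrite (TPE _ x xh); last first.
  move=> k u v uh vh; apply: etrans (congr1 T (@Phi_linear K k u v)) _.
  by apply: (antipode_linear aT); exact: span_of_predT.
apply: eq_big_seq => c cx; congr (_ *: _); apply: Phi_antipode_basis => //.
by move/allP: xh; apply.
Qed.

Lemma heap_hopf_subalgebra : is_hopf_subalgebra (Hpo K) heap_class.
Proof.
have smul : {in Hhpo K &, forall x y, Hhpo K (hmul (Hpo K) x y)}.
  move=> x y xh yh; apply: (span_of_lin xh) => c hc; apply: (span_of_lin yh) => d hd.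
  by apply: span_ofU; rewrite heap_class_of heap_union.
split=> //.
- by apply: span_ofU; rewrite heap_class_of heap_empty.
- move=> x xh; apply: (span_of_lin xh) => c hc; apply: span_of_sum => v _ _.
  by apply: span_ofU; apply/andP; split; [exact: heap_Lea|exact: heap_Roo].
move=> S aS x xh; rewrite (span_linearE (antipode_linear aS)); last exact: span_of_predT.
apply: (span_of_lin xh) => c {x xh}.
(* Stability under the antipode: the recursion writes [S << c >>] with values of [S] on smaller
   heap-preordered forests, multiplied by elements of the span. *)
have [n] := ubnP (fsize c); elim: n c => // n IH c lt hc.
rewrite (antipode_rec aS) //; apply: span_ofB.
  by apply/span_ofZ/span_ofU; rewrite heap_class_of heap_empty.
apply: span_of_sum => v _ /andP[adm vr]; apply: smul; last first.
  by apply: span_ofU; exact: heap_Roo.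
apply: IH; last exact: heap_Lea.
by have := fsize_Lea_lt adm vr; rewrite card_ord => /leq_trans; apply.
Qed.

Lemma Phi_graded_hopf_morphism :
  is_graded_hopf_morphism_on (Hpo K) heap_class (WQSymd K) (Phi K).
Proof.
split.
- by move=> c x y _ _; rewrite linearP.
- exact: Phi_unit.
- by move=> x y _ _; exact: Phi_mul.
- by move=> x _; exact: Phi_counit.
- by move=> x _; exact: Phi_comul.
- exact: Phi_antipode.
- by move=> n x _; exact: Phi_graded.
Qed.

End Antipode.

(** * The greatest word of a heap-preordered forest *)

Lemma filter_head (T : Type) (p : pred T) s u t :
  [seq y <- s | p y] = u :: t ->
  exists m s', [/\ s = m ++ u :: s', all (predC p) m & p u].
Proof.
elim: s => //= x s IH.
have [px [<- _]|px /IH[m [s' [-> pm pu]]]] := ifP; first by exists [::], s.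
by exists (x :: m), s'; split; rewrite //= px.
Qed.

Lemma seq_max d (T : orderType d) (s : seq T) : s != [::] ->
  exists2 x, x \in s & forall y, y \in s -> (y <= x)%O.
Proof.
elim: s => // a [|b s] IH _.
  by exists a; rewrite ?inE // => y; rewrite inE => /eqP->.
have [x xs xmax] := IH isT.
have [ax|xa] := leP a x.
  exists x; first by rewrite inE xs orbT.
  by move=> y; rewrite inE => /orP[/eqP->//|/xmax].
exists a; first by rewrite mem_head.
move=> y; rewrite inE => /orP[/eqP->//|/xmax yx].
exact: le_trans yx (ltW xa).
Qed.

(** Moving [v] behind the block [m] reverses only the pairs formed by [v] and a letter of [m]. *)
Lemma pairwise_delay (T : Type) (r : rel T) s1 v m s3 :
  pairwise r (s1 ++ v :: m ++ s3) -> all (fun w => r w v) m ->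
  pairwise r (s1 ++ m ++ v :: s3).
Proof.
move=> + rv; elim: s1 => [|a s1 IH]; last first.
  rewrite !cat_cons !pairwise_cons => /andP[+ /IH->]; rewrite andbT.
  by rewrite !all_cat /= !all_cat => /and4P[-> -> -> ->].
elim: m rv => //= x m IH /andP[xv mv] /andP[/andP[vx vs] /andP[xs ms]].
rewrite IH ?vs ?ms // andbT; move: xs.
by rewrite !all_cat /= xv.
Qed.

Lemma lt_cat_lexi (p s t : seq nat) (x y : nat) : (x < y)%N ->
  ((p ++ x :: s : seqlexi nat) < (p ++ y :: t : seqlexi nat))%O.
Proof.
move=> xy; elim: p => [|a p IH]; last exact: etrans (eqhead_ltxiE _ _ _) IH.
by apply: etrans (neqhead_ltxiE _ _ _) _; rewrite ?ltn_eqF ?ltEnat.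
Qed.

(** The reversal makes the lexicographic order of [seqlexi] compare words from their last letter. *)
Definition rev_word (V : finType) (F : pforest V) (s : seq V) :
  seqlexi nat := rev (map (label F) s).

Section GreatestWord.
Variables (V : finType) (F : pforest V).
Hypothesis F_heap : heap F.
Local Notation key := (rev_word F).

(** Sorting the vertices by decreasing labels gives an extension, since a parent has a smaller label
    than its children. *)
Lemma linexts_neq_nil : linexts F setT != [::].
Proof.
pose r x y := (label F y <= label F x)%N.
suff : sort r (enum V) \in linexts F setT by case: linexts.
rewrite mem_linexts sort_uniq enum_uniq /=; apply/andP; split.
  by apply/eqP/setP => x; rewrite !inE mem_sort mem_enum.
have r_total : total r by move=> x y; exact: leq_total.
have r_trans : transitive r by move=> y x z xy yz; exact: leq_trans yz xy.
have := sort_sorted r_total (enum V); rewrite (sorted_pairwise r_trans).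
apply: sub_pairwise => x y yx; apply/eqP => /(heapP _ F_heap).
by rewrite ltnNge; move/negP; apply.
Qed.

(** The move does not carry [v] past its parent, so the list remains an extension. The letters of
    [s3] are unchanged and the one just before them grows from the label of [u] to that of [v],
    which decides the comparison from the right. *)
Lemma exchange s1 v m u s3 :
    s1 ++ v :: m ++ u :: s3 \in linexts F setT ->
    (label F u < label F v)%N -> {in u :: m, forall w, parent F v != Some w} ->
  let s := s1 ++ m ++ u :: v :: s3 in
  s \in linexts F setT /\ (key (s1 ++ v :: m ++ u :: s3) < key s)%O.
Proof.
move=> sF uv pv s; split.
  have ps : perm_eq s (s1 ++ v :: m ++ u :: s3).
    rewrite /s -(cat_rcons u) -(cat_rcons u m s3) perm_cat2l -(cat1s v s3).
    by rewrite perm_catCA.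
  move: sF; rewrite !mem_linexts (perm_uniq ps) => /and3P[-> /eqP <- ls] /=.
  apply/andP; split; first by apply/eqP/setP => x; rewrite !inE (perm_mem ps).
  rewrite /s -(cat_rcons u) -cats1; apply: pairwise_delay; first by rewrite -catA.
  by apply/allP => w; rewrite mem_cat inE orbC -in_cons; exact: pv.
have keyE p x q : key (p ++ x :: q) =
    rev (map (label F) q) ++ label F x :: rev (map (label F) p).
  by rewrite /rev_word map_cat rev_cat /= rev_cons cat_rcons.
have -> : s = (s1 ++ rcons m u) ++ v :: s3 by rewrite /s -cat_rcons catA.
rewrite -(cat_cons v) (catA s1) !keyE.
exact: lt_cat_lexi.
Qed.

(** The parent of [v] comes later and has a smaller label, so it is among the candidates. If it were
    not the first of them, [exchange] would give a greater word. *)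
Lemma greatest_parent s s1 v s2 :
    s \in linexts F setT -> (forall t, t \in linexts F setT -> (key t <= key s)%O) ->
    s = s1 ++ v :: s2 ->
  parent F v = ohead [seq y <- s2 | (label F y < label F v)%N].
Proof.
move=> sF smax sE; case fE : [seq y <- s2 | _] => [|u t] /=.
  case e : (parent F v) => [p|] //.
  have pv := heapP _ F_heap _ _ e.
  have : p \in [seq y <- s2 | (label F y < label F v)%N]; last by rewrite fE.
  rewrite mem_filter pv; have := linextsT_mem p sF.
  rewrite sE mem_cat inE => /or3P[p1|/eqP pE|//]; last by rewrite pE ltnn in pv.
  move: sF; rewrite sE mem_linexts => /and3P[_ _]; rewrite /linext pairwise_cat.
  by case/and3P=> /allrelP/(_ p v p1 (mem_head _ _)); rewrite e eqxx.
have [m [s3 [s2E ml ul]]] := filter_head fE.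
apply/eqP/negPn/negP => pu.
have [||] := @exchange s1 v m u s3 _ ul; first by rewrite -s2E -sE.
  (* The labels on [m] are not smaller than that of [v], so by the heap condition no vertex of [m]
     is its parent. *)
  move=> w; rewrite inE => /orP[/eqP->//|/(allP ml) /= wv].
  by apply: contra wv => /eqP /(heapP _ F_heap).
move=> /smax le; rewrite -s2E -sE => lt.
by have := lt_le_trans lt le; rewrite ltxx.
Qed.

End GreatestWord.

(** The isomorphism matches the vertices at equal positions in [s] and [t]. By [greatest_parent] the
    parents depend only on positions and labels, so they correspond as well. *)
Lemma greatest_word_inj (V W : finType) (F : pforest V) (G : pforest W) s t :
    heap F -> heap G -> s \in linexts F setT -> t \in linexts G setT ->
    (forall s', s' \in linexts F setT -> (rev_word F s' <= rev_word F s)%O) ->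
    (forall t', t' \in linexts G setT -> (rev_word G t' <= rev_word G t)%O) ->
  map (label F) s = map (label G) t -> piso F G.
Proof.
move=> hF hG sF tG smax tmax st.
have sz : size s = size t by have := congr1 size st; rewrite !size_map.
have [sV tW] := (size_linexts sF, size_linexts tG); rewrite !cardsT in sV tW.
have us : uniq s by move: sF; rewrite mem_linexts => /andP[].
have ut : uniq t by move: tG; rewrite mem_linexts => /andP[].
(* If [t] is empty, so are both forests; otherwise its head [w0] serves as the default of [nth]. *)
case tE : t => [|w0 t']; first by apply: piso_empty; rewrite -?sV -?tW ?sz tE.
pose f v := nth w0 t (index v s).
have is_s v : (index v s < size s)%N by rewrite index_mem (linextsT_mem _ sF).
have f_inj : injective f.
  move=> x y /eqP; rewrite nth_uniq // -?sz // => /eqP /(index_inj x).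
  by apply; exact: linextsT_mem sF.
have mfs : map f s = t.
  apply: (@eq_from_nth _ w0); rewrite size_map // => i it.
  have v0 : V by case: (s) it => // v0.
  by rewrite (nth_map v0) // /f index_uniq.
have fl v : label G (f v) = label F v.
  rewrite /f -(nth_map w0 0%N) -?sz // -st (nth_map v) //.
  by rewrite nth_index // (linextsT_mem _ sF).
have dropE (U : finType) (H : pforest U) (r : seq U) v : r \in linexts H setT ->
    r = take (index v r) r ++ v :: drop (index v r).+1 r.
  move=> rH; rewrite -[LHS](cat_take_drop (index v r)); congr (_ ++ _).
  by rewrite (drop_nth v) ?index_mem ?nth_index ?(linextsT_mem _ rH).
apply/pisoP; exists f; split=> // [|v].
  by apply: inj_card_bij => //; rewrite -sV -tW sz.
rewrite (greatest_parent hG tG tmax (dropE _ _ _ (f v) tG)).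
rewrite (greatest_parent hF sF smax (dropE _ _ _ v sF)).
rewrite -mfs index_map // -map_drop filter_map.
rewrite (eq_filter (a2 := fun y => (label F y < label F v)%N)); last first.
  by move=> y /=; rewrite !fl.
by case: filter.
Qed.

(** * Triangularity and injectivity *)

Section Injectivity.
Variables (K : fieldType) (charK : [pchar K] =i pred0).

Lemma word_sum_coeff (V : finType) (F : pforest V) w :
  (word_sum K F setT)@_w =
  (count (fun s => pack_word (map (label F) s) == w) (linexts F setT))%:R.
Proof.
rewrite /word_sum raddf_sum /= -sum1_count natr_sum [RHS]big_mkcond.
by apply: eq_bigr => s _; rewrite mcoeffU; case: (_ == _).
Qed.

Lemma Phi_coeff x w : (Phi K x)@_w =
  \sum_(c <- msupp x) x@_c * (word_sum K (frepr c) setT)@_w.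
Proof.
rewrite /Phi /lin raddf_sum; apply: eq_bigr => c _.
by rewrite /= mcoeffZ Phi_forestE.
Qed.

(** Among all words of all forests in the support of a nonzero [x], take the greatest. Only one
    forest of the support spells it, so its coefficient in the image cannot cancel. *)
Lemma heap_Phi_ker x : x \in Hhpo K -> Phi K x = 0 -> x = 0.
Proof.
move=> /allP xh Px; apply/eqP; apply/contraT => x0.
have [c0 c0x] : exists c, c \in msupp x.
  case E : (enum_fset (msupp x)) => [|c r]; last first.
    by exists c; rewrite -[_ \in _]/(_ \in enum_fset _) E mem_head.
  case/eqP: x0; apply/malgP => c; rewrite mcoeff0; apply: mcoeff_outdom.
  by rewrite -[_ \in _]/(_ \in enum_fset _) E.
pose keys := [seq rev_word (frepr c) s | c <- enum_fset (msupp x),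
  s <- linexts (frepr c) setT].
have keyP c s : c \in msupp x -> s \in linexts (frepr c) setT ->
    rev_word (frepr c) s \in keys.
  by move=> cx sc; apply/allpairsPdep; exists c, s.
have [|k /allpairsPdep[c [s [cx sc kE]]] kmax] := @seq_max _ _ keys.
  have := linexts_neq_nil (xh _ c0x); case E : linexts => [//|s r] _.
  have : s \in linexts (frepr c0) setT by rewrite E mem_head.
  by move/(keyP _ _ c0x); case: (keys).
pose w := pack_word (map (label (frepr c)) s).
(* If [d] spelled [w] too, [w] would be the greatest word of both [d] and [c], because [k] bounds
   all keys; the two classes would then coincide. *)
have only d : d \in msupp x -> d != c -> (word_sum K (frepr d) setT)@_w = 0.
  move=> dx dc; rewrite word_sum_coeff; set n := count _ _.
  case: (posnP n) => [->//|]; rewrite -has_count => /hasP[t td /eqP/(congr1 val)].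
  rewrite /= !pack_id ?(packed_labels sc) ?(packed_labels td) // => ts.
  case/eqP: dc; rewrite -(class_of_frepr d) -(class_of_frepr c); apply/class_of_eq.
  apply: (greatest_word_inj (xh _ dx) (xh _ cx) td sc _ _ ts).
    move=> t' td'; have -> : rev_word (frepr d) t = k by rewrite kE /rev_word ts.
    by apply: kmax; exact: keyP.
  by move=> s' sc'; rewrite -kE; apply: kmax; exact: keyP.
have := Phi_coeff x w; rewrite Px mcoeff0 (bigD1_seq c) ?fset_uniq //=.
rewrite big_seq_cond big1 ?addr0 => [|d /andP[dx dc]]; last by rewrite only ?mulr0.
(* The coefficient at [w] is that of [c] times the number of extensions spelling [w]. This number is
   positive because of [s], hence nonzero in characteristic zero. *)
rewrite word_sum_coeff => /esym/eqP; rewrite mulf_eq0 mcoeff_eq0 cx /=.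
rewrite (pcharf0P _).1 // eqn0Ngt -has_count => /hasP[]; by exists s.
Qed.

Lemma Phi_inj_on_heap : {in Hhpo K &, injective (Phi K)}.
Proof.
move=> x y xh yh e; apply/eqP; rewrite -subr_eq0; apply/eqP/heap_Phi_ker.
  exact: span_ofB.
by rewrite PhiB e subrr.
Qed.

End Injectivity.

Theorem mainTheorem3 (K : fieldType) (charK : [pchar K]%R =i pred0) :
  {in Hhpo K &, injective (Phi K)} /\
  is_hopf_subalgebra (Hpo K) heap_class /\
  is_graded_hopf_morphism_on (Hpo K) heap_class (WQSymd K) (Phi K).
Proof.
split; first exact: Phi_inj_on_heap.
by split; [exact: heap_hopf_subalgebra|exact: Phi_graded_hopf_morphism].
Qed.
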